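(* Let $\alpha:A^*\to M$ be an alphabet compatible morphism into a finite monoid $M$. Let $n\geqslant 1$ and $\ell_{2,n}=9n|M|^2\cdot 2^{|M|^{n-1}}$. Then $$\mathcal J_{2,n}[\alpha]=\mathcal J_{2,n}^{\ell_{2,n}}[\alpha]=\mathrm{Sat}_n(\mathcal D_n).$$
   Context: $A$ is a finite alphabet. Words over $A$ (including the empty word) are logical structures with positions linearly ordered by $<$ and labeled by letters; $\mathrm{FO}(<)$ uses unary predicates $P_a$ ($a\in A$) and $<$. A formula is $\Sigma_2(<)$ if its prenex normal form has exactly two quantifier blocks, the first one existential, or at most one block; formulas are not required to be literally prenex, i.e. one considers all first-order formulas that become $\Sigma_2$ after prenexing, and the quantifier rank (longest sequence of nested quantifiers) is measured on the formula itself. Write $w\lesssim^k_2 w'$ if every $\Sigma_2(<)$ sentence of quantifier rank at most $k$ satisfied by $w$ is satisfied by $w'$. Equivalently, Duplicator wins the following $k$-round Ehrenfeucht–Fraïssé game: initially $w$ is the active word; in each round Spoiler pebbles a position in the active word, or (at most once in the whole game) switches the active word to the other one and pebbles a position there; Duplicator answers by pebbling a position in the other word so that the pebble correspondence preserves labels and $<$ in both directions. $\mathsf{alph}(w)$ is the set of letters of $w$. $\alpha$ is alphabet compatible if $\alpha(u)=\alpha(v)$ implies $\mathsf{alph}(u)=\mathsf{alph}(v)$; then $\mathsf{alph}(s)$, for $s\in M$, is the common alphabet of the words in $\alpha^{-1}(s)$ ($\emptyset$ if there is none). $\mathcal C_{2,n}[\alpha]$ is the set of $(s_1,\dots,s_n)\in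 M^n$ such that for every $k\in\mathbb N$ there are words $w_1\lesssim^k_2\cdots\lesssim^k_2 w_n$ with $\alpha(w_j)=s_j$ for all $j$. A juncture of length $n$ is a pair $(t,\mathcal T)\in M\times 2^{M^{n-1}}$. $\mathcal J_{2,n}^k[\alpha]$ is the set of junctures $(t,\mathcal T)$ of length $n$ for which there is $w\in A^*$ with $\alpha(w)=t$ such that for every $(t_2,\dots,t_n)\in\mathcal T$ there are $w_2,\dots,w_n\in A^*$ with $w\lesssim^k_2 w_2\lesssim^k_2\cdots\lesssim^k_2 w_n$ and $\alpha(w_j)=t_j$ for all $j$. $\mathcal J_{2,n}[\alpha]=\bigcap_k\mathcal J^k_{2,n}[\alpha]$. The set $M\times 2^{M^{n-1}}$ is a monoid under $(s,\mathcal S)\cdot(t,\mathcal T)=(st,\{\bar s\bar t\mid\bar s\in\mathcal S,\bar t\in\mathcal T\})$ (componentwise products); $\omega\geqslant 1$ is an integer such that all $\omega$-th powers in this monoid are idempotent. For a set $\mathcal X$ of junctures, $\downarrow\mathcal X=\{(r,\mathcal R)\mid\exists(r,\mathcal S)\in\mathcal X,\ \mathcal R\subseteq\mathcal S\}$. $\mathcal D_n=\{(\alpha(w),\{(\alpha(w),\dots,\alpha(w))\})\mid w\in A^*\}\subseteq M\times 2^{M^{n-1}}$. For $\mathcal R\subseteq M\times 2^{M^{n-1}}$: if $n=1$, $\mathrm{Sat}_1$ is the identity, i.e. $\mathrm{Sat}_1(\mathcal R)=\mathcal R$; if $n\geqslant2$, $\mathrm{Sat}_n(\mathcal R)$ is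 the smallest subset $\mathcal X$ of $M\times 2^{M^{n-1}}$ containing $\mathcal R$ such that (i) $\downarrow\mathcal X\subseteq\mathcal X$; (ii) $\mathcal X\cdot\mathcal X\subseteq\mathcal X$; (iii) for all $(s,\mathcal S)\in\mathcal X$, setting $\mathcal T=\{(t_1,\dots,t_{n-1})\in\mathcal C_{2,n-1}[\alpha]\mid\mathsf{alph}(t_1)=\mathsf{alph}(s)\}$, one has $(s,\mathcal S)^\omega\cdot(1_M,\mathcal T)\cdot(s,\mathcal S)^\omega\in\mathcal X$.
   Formalization: For n = 1 the pairs (s, ∅) are excluded from the junctures of length 1, since (α(w), ∅) would lie vacuously in J_{2,1}[α] but not in Sat_1(D_1) = D_1; nothing is changed for n ≥ 2. *)

(* Defs.v *)
From HB Require Import structures.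
From mathcomp Require Import all_boot.
From mathcomp Require Import boolp classical_sets.

Set Implicit Arguments.
Unset Strict Implicit.
Unset Printing Implicit Defensive.

Local Open Scope classical_set_scope.

(** * Monoids *)

#[short(type="finMonoidType")]
HB.structure Definition FinMonoid := {M of monoid.Monoid M & Finite M}.

(* The free monoid A^* is [seq A] under concatenation. *)
HB.instance Definition _ (A : choiceType) :=
  isMonoid.Build (seq A) (@catA A) (@cat0s A) (@cats0 A).

Section TupleMonoid.
Variables (M : monoidType) (m : nat).
Implicit Types s t u : m.-tuple M.

Definition tuple_mul s t : m.-tuple M := [tuple (tnth s i * tnth t i)%g | i < m].
Definition tuple_one : m.-tuple M := [tuple 1%g | i < m].

Lemma tuple_mulA : associative tuple_mul.
Proof. by move=> s t u; apply: eq_from_tnth => i; rewrite !tnth_mktuple mulgA. Qed.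
Lemma tuple_mul1 : left_id tuple_one tuple_mul.
Proof. by move=> s; apply: eq_from_tnth => i; rewrite !tnth_mktuple mul1g. Qed.
Lemma tuple_mulr1 : right_id tuple_one tuple_mul.
Proof. by move=> s; apply: eq_from_tnth => i; rewrite !tnth_mktuple mulg1. Qed.

HB.instance Definition _ :=
  isMonoid.Build (m.-tuple M) tuple_mulA tuple_mul1 tuple_mulr1.
End TupleMonoid.

(* 2^{M^m}.  This is a named copy of [{set m.-tuple M}] so that its product does
   not compete with the set product of finite groups. *)
Definition tuple_set (M : finMonoidType) (m : nat) : Type := {set m.-tuple M}.

Section TupleSetMonoid.
Variables (M : finMonoidType) (m : nat).

HB.instance Definition _ := Finite.on (tuple_set M m).

Implicit Types S T : tuple_set M m.

Definition tuple_set_mul S T : tuple_set M m :=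
  [set tuple_mul s t | s in S, t in T]%SET.
Definition tuple_set_one : tuple_set M m := [set tuple_one M m]%SET.

Lemma tuple_set_mulP S T (x : m.-tuple M) :
  reflect (exists s t, [/\ s \in S, t \in T & x = tuple_mul s t])
          (x \in tuple_set_mul S T).
Proof.
apply: (iffP imset2P) => [[s t sS tT ->]|[s [t [sS tT ->]]]].
  by exists s, t.
by exists s t.
Qed.

Lemma tuple_set_mulA : associative tuple_set_mul.
Proof.
move=> S T U; apply/setP => x; apply/tuple_set_mulP/tuple_set_mulP.
  case=> s [_ [sS /tuple_set_mulP[t [u [tT uU ->]]] ->]].
  exists (tuple_mul s t), u; split; rewrite ?tuple_mulA//.
  by apply/tuple_set_mulP; exists s, t.
case=> _ [u [/tuple_set_mulP[s [t [sS tT ->]]] uU ->]].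
exists s, (tuple_mul t u); split; rewrite ?tuple_mulA//.
by apply/tuple_set_mulP; exists t, u.
Qed.

Lemma tuple_set_mul1 : left_id tuple_set_one tuple_set_mul.
Proof.
move=> S; apply/setP => x; apply/tuple_set_mulP/idP.
  by case=> _ [s [/set1P-> sS ->]]; rewrite tuple_mul1.
by move=> xS; exists (tuple_one M m), x; rewrite tuple_mul1 set11.
Qed.

Lemma tuple_set_mulr1 : right_id tuple_set_one tuple_set_mul.
Proof.
move=> S; apply/setP => x; apply/tuple_set_mulP/idP.
  by case=> s [_ [sS /set1P-> ->]]; rewrite tuple_mulr1.
by move=> xS; exists x, (tuple_one M m); rewrite tuple_mulr1 set11.
Qed.

HB.instance Definition _ :=
  isMonoid.Build (tuple_set M m) tuple_set_mulA tuple_set_mul1 tuple_set_mulr1.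
End TupleSetMonoid.

(* M x 2^{M^{n-1}}; its monoid structure is the direct product of the above. *)
Notation juncture M n := (M * tuple_set M n.-1)%type.

(** * First-order logic over words *)

Inductive quantifier := Exists | Forall.
Inductive connective := And | Or.

(* Formulas over the alphabet A with free variables in V.  In [Quant q f] the
   bound variable is [None], and [Some x] stands for the outer variable [x]. *)
Inductive formula (A V : Type) : Type :=
| Falsum
| Label of A & V
| Less of V & V
| Equal of V & V
| Neg of formula A V
| Conn of connective & formula A V & formula A V
| Quant of quantifier & formula A (option V).

Arguments Falsum {A V}.
Arguments Label {A V}.
Arguments Less {A V}.
Arguments Equal {A V}.

Definition sentence (A : Type) := formula A void.

Fixpoint qrank (A V : Type) (f : formula A V) : nat :=
  match f with
  | Neg g => qrank g
  | Conn _ g h => maxn (qrank g) (qrank h)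
  | Quant _ g => (qrank g).+1
  | _ => 0
  end.

Fixpoint holds (A : finType) (w : seq A) (V : Type) (f : formula A V) :
    (V -> 'I_(size w)) -> bool :=
  match f with
  | Falsum => fun=> false
  | Label a x => fun e => tnth (in_tuple w) (e x) == a
  | Less x y => fun e => (e x < e y)%N
  | Equal x y => fun e => e x == e y
  | Neg g => fun e => ~~ holds g e
  | Conn And g h => fun e => holds g e && holds h e
  | Conn Or g h => fun e => holds g e || holds h e
  | Quant Exists g => fun e => [exists i, holds g (fun x => oapp e i x)]
  | Quant Forall g => fun e => [forall i, holds g (fun x => oapp e i x)]
  end.

Definition satisfies (A : finType) (w : seq A) (f : sentence A) : bool :=
  holds f (@of_void 'I_(size w)).

Fixpoint rename (A V W : Type) (f : formula A V) : (V -> W) -> formula A W :=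
  match f with
  | Falsum => fun=> Falsum
  | Label a x => fun r => Label a (r x)
  | Less x y => fun r => Less (r x) (r y)
  | Equal x y => fun r => Equal (r x) (r y)
  | Neg g => fun r => Neg (rename g r)
  | Conn c g h => fun r => Conn c (rename g r) (rename h r)
  | Quant q g => fun r => Quant q (rename g (omap r))
  end.

Definition lift_formula (A V : Type) (f : formula A V) : formula A (option V) :=
  rename f Some.

Definition dual (q : quantifier) := if q is Exists then Forall else Exists.

(* Pulling one quantifier outwards, anywhere in the formula.  The rules are
   syntactic: the prefix class is meaningful also for the empty word, on which
   pulling a quantifier out of a connective may change the truth value. *)
Inductive prenex_step (A V : Type) : formula A V -> formula A V -> Prop :=
| prenex_neg q f : prenex_step (Neg (Quant q f)) (Quant (dual q) (Neg f))
| prenex_connl c q f g :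
    prenex_step (Conn c (Quant q f) g) (Quant q (Conn c f (lift_formula g)))
| prenex_connr c q f g :
    prenex_step (Conn c g (Quant q f)) (Quant q (Conn c (lift_formula g) f))
| prenex_in_neg f f' : prenex_step f f' -> prenex_step (Neg f) (Neg f')
| prenex_in_connl c f f' g :
    prenex_step f f' -> prenex_step (Conn c f g) (Conn c f' g)
| prenex_in_connr c f f' g :
    prenex_step f f' -> prenex_step (Conn c g f) (Conn c g f')
| prenex_in_quant q f f' :
    prenex_step f f' -> prenex_step (Quant q f) (Quant q f').

Inductive prenexes (A V : Type) (f : formula A V) : formula A V -> Prop :=
| prenexes_refl : prenexes f f
| prenexes_step g h : prenexes f g -> prenex_step g h -> prenexes f h.

Fixpoint quantifier_free (A V : Type) (f : formula A V) : bool :=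
  match f with
  | Neg g => quantifier_free g
  | Conn _ g h => quantifier_free g && quantifier_free h
  | Quant _ _ => false
  | _ => true
  end.

Fixpoint prenex_forall (A V : Type) (f : formula A V) : bool :=
  if f is Quant Forall g then prenex_forall g else quantifier_free f.

(* Prenex formulas with prefix in Exists^* Forall^*, that is, with two blocks,
   the first one existential, or with at most one block. *)
Fixpoint prenex_sigma2 (A V : Type) (f : formula A V) : bool :=
  if f is Quant Exists g then prenex_sigma2 g else prenex_forall f.

Definition sigma2 (A V : Type) (f : formula A V) : Prop :=
  exists2 g, prenexes f g & prenex_sigma2 g.

Definition lesssim2 (A : finType) (k : nat) : rel (seq A) := fun w w' =>
  `[< forall f : sentence A,
        sigma2 f -> (qrank f <= k)%N -> satisfies w f -> satisfies w' f >].

(** * Chains and junctures *)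

Section Junctures.
Unset Implicit Arguments.
Variables (A : finType) (M : finMonoidType).
Variable alpha : UMagmaMorphism.type (seq A) M.

Definition alph (w : seq A) : {set A} := [set a | a \in w]%SET.

Definition alphabet_compatible :=
  forall u v, alpha u = alpha v -> alph u = alph v.

(* The union of the alphabets of the preimages of s, which is their common
   alphabet when alpha is alphabet compatible (see [alph_of_image]). *)
Definition alph_of (s : M) : {set A} :=
  [set a | `[< exists2 w, alpha w = s & a \in alph w >]]%SET.

Lemma alph_of_image w : alphabet_compatible -> alph_of (alpha w) = alph w.
Proof.
move=> alphaP; apply/setP => a; rewrite inE; apply/asboolP/idP => [|aw].
  by case=> v /alphaP ->.
by exists w.
Qed.

Lemma alph_of_notin_image s : ~ (exists w, alpha w = s) -> alph_of s = finset.set0.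
Proof.
move=> Ns; apply/setP => a; rewrite !inE; apply/asboolP => -[w ws _].
by apply: Ns; exists w.
Qed.

Definition chains (n : nat) : set (n.-tuple M) :=
  [set s : n.-tuple M | forall k, exists2 ws : seq (seq A),
    sorted (lesssim2 k) ws & map alpha ws = s].

(* For n = 1, M^{n-1} consists of the empty tuple alone, and a juncture of length
   1 carries no information beyond an element s of M: it is the pair
   (s, {()}), which is the shape taken by [diagonal_junctures 1].  The pair
   (s, {}) is discarded: for s in the image of alpha it would lie in [junctures 1] but
   not in [Sat 1 (diagonal_junctures 1)], as [Sat 1] is the identity. *)
Definition is_juncture (n : nat) (x : juncture M n) : Prop :=
  n = 1 -> x.2 <> finset.set0.

Definition junctures_rank (k n : nat) : set (juncture M n) :=
  [set x : juncture M n | is_juncture n x /\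
    exists2 w, alpha w = x.1 &
      forall t, t \in x.2 -> exists2 ws : seq (seq A),
        path (lesssim2 k) w ws & map alpha ws = t].

Definition junctures (n : nat) : set (juncture M n) :=
  \bigcap_k junctures_rank k n.

Definition diagonal_junctures (n : nat) : set (juncture M n) :=
  [set x | exists w : seq A,
    x = (alpha w, [set [tuple alpha w | i < n.-1]]%SET)].

Definition down_closure (n : nat) (X : set (juncture M n)) : set (juncture M n) :=
  [set x : juncture M n | exists2 S : tuple_set M n.-1, X (x.1, S) & x.2 \subset S].

(* For n > 1 the tuple t is nonempty and [head 1%g t] is its first component. *)
Definition compatible_chains (n : nat) (s : M) : tuple_set M n.-1 :=
  [set t : n.-1.-tuple M |
    (t \in chains n.-1) && (alph_of (head 1%g t) == alph_of s)]%SET.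

Definition sat_closed (omega n : nat) (X : set (juncture M n)) : Prop :=
  [/\ down_closure n X `<=` X,
      [set (x * y)%g | x in X & y in X] `<=` X &
      forall x, X x ->
        X (x ^+ omega * (1, compatible_chains n x.1) * x ^+ omega)%g].

Definition Sat (omega n : nat) (R : set (juncture M n)) : set (juncture M n) :=
  if n == 1 then R else smallest (sat_closed omega n) R.

Definition ell (n : nat) : nat := 9 * n * #|M| ^ 2 * 2 ^ (#|M| ^ n.-1).

End Junctures.

Arguments alph {A}.
Arguments alphabet_compatible {A M} alpha.
Arguments alph_of {A M} alpha.
Arguments chains {A M} alpha n _.
Arguments is_juncture {M} n x.
Arguments junctures_rank {A M} alpha k n _.
Arguments junctures {A M} alpha n _.
Arguments diagonal_junctures {A M} alpha n _.
Arguments down_closure {M} n X _.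
Arguments compatible_chains {A M} alpha n s.
Arguments sat_closed {A M} alpha omega n X.
Arguments Sat {A M} alpha omega n R _.

(* Main.v *)
(** Soundness.  Two words are compared by the Ehrenfeucht-Fraïssé game; a pebble
    splits both words, and the two sides are then played independently, so that
    [lesssim2] is a precongruence.  As [w^p] and [w^q x w^q] are related for large
    [p] and [q] when [x] uses only letters of [w], junctures are closed under the
    saturation rules.

    Completeness.  For n >= 2 let [k0] be the rank of dimension n - 1, at which the
    chains of length n - 1 are exactly the elements of C_(2,n-1).  A juncture [x]
    covers [w] at height [h] if it contains all tuples of images of chains of rank
    [k0 + h] starting at [w].  Covers multiply at the cost of one round.  If all the
    factors of a product are covered by the same idempotent [e], then the whole
    product is covered, two rounds later, by a power of [e (1,T) e]: split off the
    first and the last factor, and use that the middle one is known up to its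
    alphabet.  A factorization forest argument over the finite monoid of junctures
    of size N then covers every word at height 9 N.  Contrary to Simon's theorem,
    such a power can be J-below [e], so the forest is built one J-class at a time,
    from the top, and factors whose cover drops are collected greedily. *)

Require Import Defs.
From HB Require Import structures.
From mathcomp Require Import all_boot zify.
From mathcomp Require Import boolp classical_sets.

Set Implicit Arguments.
Unset Strict Implicit.
Unset Printing Implicit Defensive.

(** * The two-sided game *)

Lemma cat_eq_mid (T : Type) (u v x y : seq T) a : u ++ v = x ++ a :: y ->
  (exists2 u2, u = x ++ a :: u2 & y = u2 ++ v) \/
  (exists2 v1, x = u ++ v1 & v = v1 ++ a :: y).
Proof.
elim: u x => [|b u IH] x /=; first by move=> ->; right; exists x.
case: x => [[-> <-]|c x [-> /IH[[u2 -> ->]|[v1 -> ->]]]]; first by left; exists u.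
  by left; exists u2.
by right; exists v1.
Qed.

Lemma map_eq_mid (T T' : Type) (g : T -> T') u x a y : map g u = x ++ a :: y ->
  exists u1 c u2, [/\ u = u1 ++ c :: u2, map g u1 = x, g c = a & map g u2 = y].
Proof.
elim: u x => [|b u IH] [|c x] //= [].
  by move=> <- <-; exists [::], b, u.
by move=> <- /IH[u1 [d [u2 [-> <- <- <-]]]]; exists (b :: u1), d, u2.
Qed.

Section Game.
Variables (L : Type) (p : pred L).
Implicit Types (u v w : seq L) (R : seq L -> seq L -> Prop).

Definition forth R u v := forall u1 a u2, u = u1 ++ a :: u2 ->
  exists v1 v2, [/\ v = v1 ++ a :: v2, R u1 v1 & R u2 v2].

(* After a pebble is placed the two sides of it are independent subgames.  In
   [game1] Spoiler may not switch words any more.  The letters satisfying [p]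
   carry pebbles placed earlier, which the answers must respect. *)
Fixpoint game1 k u v : Prop := filter p u = filter p v /\
  if k is k'.+1 then forth (game1 k') u v else True.

Fixpoint game2 k u v : Prop := filter p u = filter p v /\
  if k is k'.+1 then forth (game2 k') u v /\ forth (game1 k') v u else True.

Lemma forth_mono R R' u v : (forall x y, R x y -> R' x y) -> forth R u v -> forth R' u v.
Proof.
move=> RR' F u1 a u2 /(F _ _ _)[v1 [v2 [-> R1 R2]]].
by exists v1, v2; split=> //; exact: RR'.
Qed.

Lemma forth_refl R u : (forall x, R x x) -> forth R u u.
Proof. by move=> Rxx u1 a u2 ->; exists u1, u2. Qed.

(** The pebble falls into one of the two factors; the other factor is carried over whole to one side
    of it, and there [R u u'] or [R v v'] is used besides the [forth] hypotheses. *)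
Lemma forth_cat R u u' v v' :
  (forall x x' y y', R x x' -> R y y' -> R (x ++ y) (x' ++ y')) ->
  R u u' -> R v v' -> forth R u u' -> forth R v v' -> forth R (u ++ v) (u' ++ v').
Proof.
move=> Rcat Ru Rv Fu Fv x a y eq_uv.
have [[u2 def_u ->]|[v1 -> def_v]] := cat_eq_mid eq_uv.
  have [x' [u2' [-> Rx Ru2]]] := Fu _ _ _ def_u.
  by exists x', (u2' ++ v'); rewrite -catA; split=> //; exact: Rcat.
have [v1' [y' [-> Rv1 Ry]]] := Fv _ _ _ def_v.
by exists (u' ++ v1'), y'; rewrite -catA; split=> //; exact: Rcat.
Qed.

Lemma game1_filter k u v : game1 k u v -> filter p u = filter p v.
Proof. by case: k => [|k] []. Qed.
Lemma game2_filter k u v : game2 k u v -> filter p u = filter p v.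
Proof. by case: k => [|k] []. Qed.

Lemma game1_pred k u v : game1 k.+1 u v -> game1 k u v.
Proof.
elim: k u v => [|k IH] u v; first by case.
by move=> -[puv F]; split=> //; apply: forth_mono F => x y; exact: IH.
Qed.

Lemma game2_pred k u v : game2 k.+1 u v -> game2 k u v.
Proof.
elim: k u v => [|k IH] u v; first by case.
case=> puv [F B]; split=> //; split; first by apply: forth_mono F => x y; exact: IH.
by apply: forth_mono B => x y; exact: game1_pred.
Qed.

Lemma game1_refl k u : game1 k u u.
Proof. by elim: k u => [|k IH] u; split=> //; exact: forth_refl. Qed.

Lemma game2_refl k u : game2 k u u.
Proof.
elim: k u => [|k IH] u; split=> //; split; first exact: forth_refl.
by apply: forth_refl => x; exact: game1_refl.
Qed.

Lemma game1_cat k u u' v v' : game1 k u u' -> game1 k v v' -> game1 k (u ++ v) (u' ++ v').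
Proof.
elim: k u u' v v' => [|k IH] u u' v v' Gu Gv; split=> //; rewrite ?filter_cat;
  try by rewrite (game1_filter Gu) (game1_filter Gv).
by apply: forth_cat; [exact: IH | exact: game1_pred | exact: game1_pred | case: Gu | case: Gv].
Qed.

Lemma game2_cat k u u' v v' : game2 k u u' -> game2 k v v' -> game2 k (u ++ v) (u' ++ v').
Proof.
elim: k u u' v v' => [|k IH] u u' v v' Gu Gv; split=> //; rewrite ?filter_cat;
  try by rewrite (game2_filter Gu) (game2_filter Gv).
have := game2_pred Gu; have := game2_pred Gv.
case: Gu => pu [Fu Bu]; case: Gv => pv [Fv Bv] Gu Gv.
split; first by apply: forth_cat.
by apply: forth_cat => //; [exact: game1_cat | exact: game1_pred | exact: game1_pred].
Qed.
End Game.

(** A strategy survives any relabelling that respects which letters are pebbled. This serves to let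
    a new variable into decorated words, and to pass from plain words to words decorated by no
    variable. *)
Lemma game_map (L L' : Type) (p : pred L) (p' : pred L') (g : L -> L') :
  (forall c, p' (g c) = p c) -> forall k u v,
  (game1 p k u v -> game1 p' k (map g u) (map g v)) /\
  (game2 p k u v -> game2 p' k (map g u) (map g v)).
Proof.
move=> pg; have pg' u v : filter p u = filter p v ->
    filter p' (map g u) = filter p' (map g v).
  by rewrite !filter_map; do !rewrite (eq_filter (a2 := p)) //; move=> ->.
have forth_map (R R' : _ -> _ -> Prop) u v :
    (forall x y, R x y -> R' (map g x) (map g y)) ->
    forth R u v -> forth R' (map g u) (map g v).
  move=> RR' F x a y eq_u; have [u1 [c [u2 [def_u <- <- <-]]]] := map_eq_mid eq_u.
  have [v1 [v2 [-> R1 R2]]] := F _ _ _ def_u.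
  exists (map g v1), (map g v2); rewrite map_cat; split=> //; exact: RR'.
elim=> [|k IH] u v; first by split=> -[/pg'].
split=> [[/pg' puv F]|[/pg' puv [F B]]]; split=> //.
  by apply: forth_map F => x y; case: (IH x y).
by split; [apply: forth_map F | apply: forth_map B] => x y; case: (IH x y).
Qed.

(** * Words decorated by valuations, and preservation of truth along the game *)

Section Decorated.
Variable A : finType.

(** A letter of a decorated word is a letter of [A] with the predicate of the variables placed on
    it. As [V] is an arbitrary type, the existence of such a variable is decided classically. *)
Definition pebbled (V : Type) (b : A * (V -> bool)) : bool := `[< exists x, b.2 x >].

(** [n] is the position of the first letter of [w] in a larger word, so that a factor of a decorated
    word is decorated by the same [e]. *)
Fixpoint decor (V : Type) n (e : V -> nat) (w : seq A) : seq (A * (V -> bool)) :=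
  if w is a :: w' then (a, fun x => e x == n) :: decor n.+1 e w' else [::].

Lemma decor_cat (V : Type) n (e : V -> nat) u v :
  decor n e (u ++ v) = decor n e u ++ decor (n + size u) e v.
Proof.
by elim: u n => [|a u IH] n /=; rewrite ?addn0 // IH addSnnS.
Qed.

Lemma decor_mid (V : Type) n (e : V -> nat) w x b y : decor n e w = x ++ b :: y ->
  exists w1 a w2, [/\ w = w1 ++ a :: w2, x = decor n e w1,
    b = (a, fun x => e x == n + size w1) & y = decor (n + size w1).+1 e w2].
Proof.
elim: w n x => [|a w IH] n [|c x] //= [].
  by move=> <- <-; exists [::], a, w; rewrite addn0.
by move=> <- /IH[w1 [d [w2 [-> -> -> ->]]]]; exists (a :: w1), d, w2; rewrite /= addSnnS.
Qed.

Definition add_pebble (V : Type) (t : bool) (b : A * (V -> bool)) : A * (option V -> bool) :=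
  (b.1, fun x => oapp b.2 t x).

Lemma decor_add (V : Type) n (e : V -> nat) w i : (i < n) || (n + size w <= i) ->
  decor n (oapp e i) w = map (add_pebble false) (decor n e w).
Proof.
elim: w n => //= a w IH n out; rewrite IH; last by lia.
congr (_ :: _); rewrite /add_pebble /=; congr (_, _); apply/funext => -[x|] //=.
by apply/eqP; lia.
Qed.

Lemma decor_add_mid (V : Type) (e : V -> nat) w w1 a w2 : w = w1 ++ a :: w2 ->
  decor 0 (oapp e (size w1)) w =
  map (add_pebble false) (decor 0 e w1) ++ add_pebble true (a, fun x => e x == size w1) ::
    map (add_pebble false) (decor (size w1).+1 e w2).
Proof.
move=> ->; rewrite decor_cat /= !decor_add ?add0n ?ltnSn ?leqnn ?orbT //.
congr (_ ++ _ :: _); rewrite /add_pebble /=; congr (_, _).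
by apply/funext => -[x|] //=; rewrite eqxx.
Qed.

Lemma pebbled_add (V : Type) (b : A * (V -> bool)) : pebbled (add_pebble false b) = pebbled b.
Proof.
apply/asboolP/asboolP => [[[x|] //= bx]|[x bx]]; first by exists x.
by exists (Some x).
Qed.

(** The order of two variables, read off the decoration. Like the predicates of [has_pebbled], it
    survives the erasure of the letters without a pebble, so that equality of the filtered words
    settles the atomic formulas. *)
Fixpoint precedes (V : Type) (x y : V) (s : seq (A * (V -> bool))) : bool :=
  if s is b :: s' then b.2 x && has (fun c => c.2 y) s' || precedes x y s' else false.

Lemma has_pebbled (V : Type) (Q : pred (A * (V -> bool))) s : (forall b, Q b -> pebbled b) ->
  has Q (filter (@pebbled V) s) = has Q s.
Proof.
move=> Qp; elim: s => //= b s IH; case: ifP => /= pb; rewrite IH //.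
by case Qb: (Q b) => //; rewrite (Qp b) in pb.
Qed.

Lemma precedes_pebbled (V : Type) (x y : V) s :
  precedes x y (filter (@pebbled V) s) = precedes x y s.
Proof.
elim: s => //= b s IH; case: ifP => /= pb; rewrite IH.
  by rewrite has_pebbled // => c cy; apply/asboolP; exists y.
by case bx: (b.2 x) => //; case/asboolP: pb; exists x.
Qed.

Lemma has_decor (V : Type) n (e : V -> nat) w y :
  has (fun c => c.2 y) (decor n e w) = (n <= e y < n + size w).
Proof.
elim: w n => [|a w IH] n /=; first by apply/esym/negbTE; lia.
by rewrite IH; lia.
Qed.

Lemma has_eq_decor (V : Type) n (e : V -> nat) w x y :
  has (fun c => c.2 x && c.2 y) (decor n e w) = (e x == e y) && (n <= e y < n + size w).
Proof.
elim: w n => [|a w IH] n /=; first by apply/esym/negbTE; lia.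
by rewrite IH; lia.
Qed.

Lemma has_label_decor (V : Type) n (e : V -> nat) w x a :
  has (fun c => (c.1 == a) && c.2 x) (decor n e w) =
  (n <= e x < n + size w) && (nth a w (e x - n) == a).
Proof.
elim: w n => [|c w IH] n /=; first by apply/esym/negbTE; lia.
rewrite IH; have [->|ne] := eqVneq (e x) n; first by rewrite subnn /=; lia.
have [lt|le] := ltnP n (e x); last by lia.
by rewrite (_ : e x - n = (e x - n.+1).+1) /=; lia.
Qed.

Lemma precedes_decor (V : Type) n (e : V -> nat) w x y :
  precedes x y (decor n e w) = [&& n <= e x, e x < e y & e y < n + size w].
Proof.
elim: w n => [|a w IH] n /=; first by apply/esym/negbTE; lia.
by rewrite IH has_decor; lia.
Qed.

Definition positions (V : Type) w (e : V -> 'I_(size w)) := decor 0 (fun x => val (e x)) w.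

Lemma positions_extend (V : Type) w (e : V -> 'I_(size w)) i :
  positions (fun x => oapp e i x) = decor 0 (oapp (fun x => val (e x)) (val i)) w.
Proof. by rewrite /positions; congr decor; apply/funext => -[]. Qed.

(** The game cuts a word at a pebble, whereas a quantifier adds a variable to the whole word; this
    condition reconciles the two views by gluing the sides back together. *)
Definition adds_pebble (V : Type) (R : seq (A * (V -> bool)) -> seq (A * (V -> bool)) -> Prop)
    (R' : seq (A * (option V -> bool)) -> seq (A * (option V -> bool)) -> Prop) :=
  forall b x x' y y', R x x' -> R y y' ->
   R' (map (add_pebble false) x ++ add_pebble true b :: map (add_pebble false) y)
      (map (add_pebble false) x' ++ add_pebble true b :: map (add_pebble false) y').

(** A quantifier amounts to a round: [i] is the move of Spoiler, and since a factorization of a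
    decorated word comes from one of [v] by [decor_mid], the answer determines [j]. *)
Lemma forth_positions (V : Type) R R' u v (e : V -> 'I_(size u)) (e' : V -> 'I_(size v)) :
  adds_pebble R R' -> forth R (positions e) (positions e') -> forall i, exists j,
  R' (positions (fun x => oapp e i x)) (positions (fun x => oapp e' j x)).
Proof.
move=> RR' F i.
have [u1 [a [u2 [def_u def_i]]]] : exists u1 a u2, u = u1 ++ a :: u2 /\ val i = size u1.
  exists (take i u), (tnth (in_tuple u) i), (drop i.+1 u); split.
    by rewrite (tnth_nth (tnth (in_tuple u) i)) /= -drop_nth ?cat_take_drop.
  by rewrite size_takel // ltnW.
rewrite positions_extend def_i; move: F; rewrite {1}/positions.
move: (fun x => val (e x)) => f; rewrite {e i def_i}def_u => F.
have := F (decor 0 f u1) (a, fun x => f x == size u1) (decor (size u1).+1 f u2).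
rewrite decor_cat /= add0n => /(_ erefl)[x [y [def_v R1 R2]]].
have [v1 [c [v2 [def_v' def_x [def_c def_f] def_y]]]] := decor_mid def_v.
have lt_v1 : size v1 < size v by rewrite def_v' size_cat /= addnS ltnS leq_addr.
exists (Ordinal lt_v1); rewrite positions_extend /=.
rewrite (decor_add_mid _ erefl) (decor_add_mid _ def_v') -def_c.
rewrite add0n in def_y def_f; rewrite -def_f -def_x -def_y.
exact: RR'.
Qed.

Lemma adds_pebble_game1 (V : Type) k : adds_pebble (game1 (@pebbled V) k) (game1 (@pebbled _) k).
Proof.
move=> b x x' y y' Gx Gy; rewrite -cat1s -[add_pebble true b :: map _ y']cat1s.
have M u v := (game_map (@pebbled_add V) k u v).1.
by apply/game1_cat/game1_cat; [exact: M | exact: game1_refl | exact: M].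
Qed.

Lemma adds_pebble_game2 (V : Type) k : adds_pebble (game2 (@pebbled V) k) (game2 (@pebbled _) k).
Proof.
move=> b x x' y y' Gx Gy; rewrite -cat1s -[add_pebble true b :: map _ y']cat1s.
have M u v := (game_map (@pebbled_add V) k u v).2.
by apply/game2_cat/game2_cat; [exact: M | exact: game2_refl | exact: M].
Qed.

(** Alternation measured by polarity on the formula itself: [shape1] with [Exists] or [Forall]
    stands for $\Sigma_1$ or $\Pi_1$, and [shape2] for $\Sigma_2$ or $\Pi_2$. Prenexing may raise
    the quantifier rank, so the induction along the game has to run on the original formula. *)
Fixpoint shape1 (q : quantifier) (V : Type) (f : formula A V) : bool :=
  match f with
  | Neg g => shape1 (dual q) g
  | Conn _ g h => shape1 q g && shape1 q h
  | Quant q' g => match q, q' with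
      | Exists, Exists | Forall, Forall => shape1 q g | _, _ => false end
  | _ => true
  end.

Fixpoint shape2 (q : quantifier) (V : Type) (f : formula A V) : bool :=
  match f with
  | Neg g => shape2 (dual q) g
  | Conn _ g h => shape2 q g && shape2 q h
  | Quant q' g => match q, q' with
      | Exists, Exists | Forall, Forall => shape2 q g | _, _ => shape1 q' g end
  | _ => true
  end.

Lemma shape1_shape2 q q' (V : Type) (f : formula A V) : shape1 q f -> shape2 q' f.
Proof.
elim: V / f q q' => //= V.
- by move=> f IH q q'; apply: IH.
- by move=> c f IHf g IHg q q' /andP[/IHf -> /IHg ->].
- by case=> f IH [] // [] //=; exact: IH.
Qed.

Lemma shape1_rename q (V W : Type) (f : formula A V) (r : V -> W) :
  shape1 q (rename f r) = shape1 q f.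
Proof.
elim: V / f W r q => //= V.
  by move=> _ f IHf g IHg W r q; rewrite IHf IHg.
by case=> f IH W r [].
Qed.

Lemma shape2_rename q (V W : Type) (f : formula A V) (r : V -> W) :
  shape2 q (rename f r) = shape2 q f.
Proof.
elim: V / f W r q => //= V.
  by move=> _ f IHf g IHg W r q; rewrite IHf IHg.
by case=> f IH W r [] //; rewrite ?IH ?shape1_rename.
Qed.

Lemma prenex_step_shape1 q (V : Type) (f g : formula A V) :
  prenex_step f g -> shape1 q g -> shape1 q f.
Proof.
move=> fg; elim: V f g / fg q => V /=.
- by case=> f [].
- by move=> c [] f g [] //=; rewrite /lift_formula shape1_rename.
- by move=> c [] f g [] //=; rewrite /lift_formula shape1_rename.
- by move=> f f' _ IH q; apply: IH.
- by move=> c f f' g _ IH q /andP[/IH -> ->].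
- by move=> c f f' g _ IH q /andP[-> /IH ->].
- by case=> f f' _ IH [] //; apply: IH.
Qed.

(** When the pulled quantifier opens the second block, the other operand comes under it and is known
    to have level one; [shape1_shape2] brings it back to level two. *)
Lemma prenex_step_shape2 q (V : Type) (f g : formula A V) :
  prenex_step f g -> shape2 q g -> shape2 q f.
Proof.
move=> fg; elim: V f g / fg q => V /=.
- by case=> f [].
- move=> c [] f g [] //=; rewrite /lift_formula ?shape2_rename ?shape1_rename //;
  by move=> /andP[-> /shape1_shape2 ->].
- move=> c [] f g [] //=; rewrite /lift_formula ?shape2_rename ?shape1_rename //;
  by move=> /andP[/shape1_shape2 -> ->].
- by move=> f f' _ IH q; apply: IH.
- by move=> c f f' g _ IH q /andP[/IH -> ->].
- by move=> c f f' g _ IH q /andP[-> /IH ->].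
- by case=> f f' fg IH [] //; do ?[exact: prenex_step_shape1 | exact: IH].
Qed.

Lemma quantifier_free_shape1 q (V : Type) (f : formula A V) :
  quantifier_free f -> shape1 q f.
Proof.
by elim: V / f q => //= V => [f IH q /IH|c f IHf g IHg q /andP[/IHf -> /IHg ->]].
Qed.

Lemma prenex_forall_shape1 (V : Type) (f : formula A V) :
  prenex_forall f -> shape1 Forall f.
Proof.
elim: V / f => //= V; first by move=> f _; exact: quantifier_free_shape1.
  by move=> c f _ g _ /andP[]; do 2!move=> /(quantifier_free_shape1 Forall) ->.
by case.
Qed.

Lemma prenex_sigma2_shape2 (V : Type) (f : formula A V) :
  prenex_sigma2 f -> shape2 Exists f.
Proof.
elim: V / f => //= V.
- by move=> f _ /(quantifier_free_shape1 Forall) /shape1_shape2 ->.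
- move=> c f _ g _ /andP[].
  by do 2!move=> /(quantifier_free_shape1 Exists) /shape1_shape2 ->.
- by case=> f IH //; exact: prenex_forall_shape1.
Qed.

Lemma sigma2_shape2 (V : Type) (f : formula A V) : sigma2 f -> shape2 Exists f.
Proof.
case=> g fg /prenex_sigma2_shape2; elim: fg => // g' h _ IH /prenex_step_shape2 gh.
by move=> /gh /IH.
Qed.

(** The four claims are proved together: negation exchanges the two polarities, and a switch of
    words turns [game2] into [game1] with the words exchanged. *)
Lemma game_holds (V : Type) (f : formula A V) k u v
    (e : V -> 'I_(size u)) (e' : V -> 'I_(size v)) : qrank f <= k ->
  [/\ shape1 Exists f -> game1 (@pebbled V) k (positions e) (positions e') ->
        holds f e -> holds f e',
      shape1 Forall f -> game1 (@pebbled V) k (positions e) (positions e') ->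
        holds f e' -> holds f e,
      shape2 Exists f -> game2 (@pebbled V) k (positions e) (positions e') ->
        holds f e -> holds f e' &
      shape2 Forall f -> game2 (@pebbled V) k (positions e) (positions e') ->
        holds f e' -> holds f e].
Proof.
have atom V' (g : formula A V') k' u' v' (i : V' -> 'I_(size u')) (i' : V' -> 'I_(size v')) :
    (filter (@pebbled V') (positions i) = filter (@pebbled V') (positions i') ->
     holds g i = holds g i') ->
  [/\ shape1 Exists g -> game1 (@pebbled V') k' (positions i) (positions i') ->
        holds g i -> holds g i',
      shape1 Forall g -> game1 (@pebbled V') k' (positions i) (positions i') ->
        holds g i' -> holds g i,
      shape2 Exists g -> game2 (@pebbled V') k' (positions i) (positions i') ->
        holds g i -> holds g i' &
      shape2 Forall g -> game2 (@pebbled V') k' (positions i) (positions i') ->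
        holds g i' -> holds g i].
  by move=> E; split=> _ => [/game1_filter|/game1_filter|/game2_filter|/game2_filter] /E ->.
elim: V / f k u v e e' => V.
- by move=> k u v e e' _; apply: atom.
- move=> a x k u v e e' _; apply: atom => puv /=.
  have label w (i : V -> 'I_(size w)) : (tnth (in_tuple w) (i x) == a) =
      has (fun c => (c.1 == a) && c.2 x) (positions i).
    rewrite has_label_decor subn0 leq0n add0n ltn_ord /=.
    by rewrite (tnth_nth a).
  rewrite !label -(@has_pebbled V); last by move=> b /andP[_ bx]; apply/asboolP; exists x.
  by rewrite puv has_pebbled // => b /andP[_ bx]; apply/asboolP; exists x.
- move=> x y k u v e e' _; apply: atom => puv /=.
  have less w (i : V -> 'I_(size w)) : (i x < i y) = precedes x y (positions i).
    by rewrite precedes_decor leq0n add0n ltn_ord andbT.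
  by rewrite !less -precedes_pebbled puv precedes_pebbled.
- move=> x y k u v e e' _; apply: atom => puv /=.
  have equal w (i : V -> 'I_(size w)) : (i x == i y) =
      has (fun c => c.2 x && c.2 y) (positions i).
    by rewrite has_eq_decor /= add0n ltn_ord andbT.
  rewrite !equal -(@has_pebbled V); last by move=> b /andP[bx _]; apply/asboolP; exists x.
  by rewrite puv has_pebbled // => b /andP[bx _]; apply/asboolP; exists x.
- move=> g IH k u v e e' /= /(IH _ _ _ e e')[S1 P1 S2 P2].
  split=> gs G; apply: contraNN; [exact: P1 | exact: S1 | exact: P2 | exact: S2].
- move=> c g IHg h IHh k u v e e' /=; rewrite geq_max => /andP[].
  move=> /(IHg _ _ _ e e')[S1 P1 S2 P2] /(IHh _ _ _ e e')[S1' P1' S2' P2'].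
  split=> /andP[gs hs] G; case: c => /=.
  - by move=> /andP[/(S1 gs G) -> /(S1' hs G) ->].
  - by move=> /orP[/(S1 gs G) ->|/(S1' hs G) ->]; rewrite ?orbT.
  - by move=> /andP[/(P1 gs G) -> /(P1' hs G) ->].
  - by move=> /orP[/(P1 gs G) ->|/(P1' hs G) ->]; rewrite ?orbT.
  - by move=> /andP[/(S2 gs G) -> /(S2' hs G) ->].
  - by move=> /orP[/(S2 gs G) ->|/(S2' hs G) ->]; rewrite ?orbT.
  - by move=> /andP[/(P2 gs G) -> /(P2' hs G) ->].
  - by move=> /orP[/(P2 gs G) ->|/(P2' hs G) ->]; rewrite ?orbT.
- move=> q g IH [//|k] u v e e' /= le_k.
  have IHi i j := IH k _ _ (fun x => oapp e i x) (fun x => oapp e' j x) le_k.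
  split; case: q => // gs [_ G].
  + move=> /existsP[i Hi]; apply/existsP.
    have [j Gj] := forth_positions (@adds_pebble_game1 V k) G i.
    by exists j; case: (IHi i j) => S1 _ _ _; exact: S1.
  + move=> /forallP Hi; apply/forallP => i.
    have [j Gj] := forth_positions (@adds_pebble_game1 V k) G i.
    by case: (IHi i j) => _ P1 _ _; exact: P1.
  + move=> /existsP[i Hi]; apply/existsP; case: G => G _.
    have [j Gj] := forth_positions (@adds_pebble_game2 V k) G i.
    by exists j; case: (IHi i j) => _ _ S2 _; exact: S2.
  (* The position to be tested lies in [v]: Spoiler switches words, and what remains is [game1] from
     [v] to [u], hence the universal claim with the valuations exchanged. *)
  + move=> /forallP Hi; apply/forallP => i; case: G => _ G.
    have [j Gj] := forth_positions (@adds_pebble_game1 V k) G i.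
    have [_ P1 _ _] := IH k _ _ (fun x => oapp e' i x) (fun x => oapp e j x) le_k.
    exact: P1.
  + move=> /existsP[i Hi]; apply/existsP; case: G => _ G.
    have [j Gj] := forth_positions (@adds_pebble_game1 V k) G i.
    exists j; have [S1 _ _ _] := IH k _ _ (fun x => oapp e' i x) (fun x => oapp e j x) le_k.
    exact: S1.
  + move=> /forallP Hi; apply/forallP => i; case: G => G _.
    have [j Gj] := forth_positions (@adds_pebble_game2 V k) G i.
    by case: (IHi i j) => _ _ _ P2; exact: P2.
Qed.
End Decorated.
(** * Characteristic formulas *)

Section Prenex.
Variable A : finType.

Lemma prenexes_trans (V : Type) (f g h : formula A V) :
  prenexes f g -> prenexes g h -> prenexes f h.
Proof.
by move=> fg; elim=> // g' h' _ IH; exact: prenexes_step.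
Qed.

Lemma prenexes_congr (V W : Type) (F : formula A V -> formula A W) f g :
  (forall f g, prenex_step f g -> prenex_step (F f) (F g)) ->
  prenexes f g -> prenexes (F f) (F g).
Proof.
move=> FP; elim=> [|g' h _ IH /FP]; first exact: prenexes_refl.
exact: prenexes_step.
Qed.

Lemma prenexes_conn (V : Type) c (f f' g g' : formula A V) :
  prenexes f f' -> prenexes g g' -> prenexes (Conn c f g) (Conn c f' g').
Proof.
move=> ff' gg'; apply: (@prenexes_trans _ _ (Conn c f' g)).
  by apply: (@prenexes_congr _ _ (fun f => Conn c f g)) ff' => *; exact: prenex_in_connl.
by apply: (@prenexes_congr _ _ (fun g => Conn c f' g)) gg' => *; exact: prenex_in_connr.
Qed.

Lemma prenexes_quant (V : Type) q (f f' : formula A (option V)) :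
  prenexes f f' -> prenexes (Quant q f) (Quant q f').
Proof. by apply: prenexes_congr => *; exact: prenex_in_quant. Qed.

Lemma quantifier_free_rename (V W : Type) (f : formula A V) (r : V -> W) :
  quantifier_free (rename f r) = quantifier_free f.
Proof. by elim: V / f W r => //= V _ f IHf g IHg W r; rewrite IHf IHg. Qed.

Lemma prenex_forall_rename (V W : Type) (f : formula A V) (r : V -> W) :
  prenex_forall (rename f r) = prenex_forall f.
Proof.
elim: V / f W r => //= V; first by move=> f _ W r; rewrite quantifier_free_rename.
  by move=> _ f _ g _ W r; rewrite !quantifier_free_rename.
by case=> f IH W r //=.
Qed.

Lemma prenex_sigma2_rename (V W : Type) (f : formula A V) (r : V -> W) :
  prenex_sigma2 (rename f r) = prenex_sigma2 f.
Proof.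
elim: V / f W r => //= V; first by move=> f _ W r; rewrite quantifier_free_rename.
  by move=> _ f _ g _ W r; rewrite !quantifier_free_rename.
by case=> f IH W r //=; rewrite prenex_forall_rename.
Qed.

Definition pi1 (V : Type) (f : formula A V) := exists2 g, prenexes f g & prenex_forall g.

Lemma quantifier_free_prenex_forall (V : Type) (f : formula A V) :
  quantifier_free f -> prenex_forall f.
Proof. by case: f. Qed.

Lemma prenex_forall_sigma2 (V : Type) (f : formula A V) : prenex_forall f -> prenex_sigma2 f.
Proof. by case: f => // -[]. Qed.

Lemma quantifier_free_pi1 (V : Type) (f : formula A V) : quantifier_free f -> pi1 f.
Proof.
by move=> /quantifier_free_prenex_forall qf; exists f => //; exact: prenexes_refl.
Qed.

Lemma pi1_sigma2 (V : Type) (f : formula A V) : pi1 f -> sigma2 f.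
Proof. by case=> g fg /prenex_forall_sigma2; exists g. Qed.

Lemma pi1_forall (V : Type) (f : formula A (option V)) : pi1 f -> pi1 (Quant Forall f).
Proof. by case=> g fg gP; exists (Quant Forall g) => //; exact: prenexes_quant. Qed.

Lemma sigma2_exists (V : Type) (f : formula A (option V)) : sigma2 f -> sigma2 (Quant Exists f).
Proof. by case=> g fg gP; exists (Quant Exists g) => //; exact: prenexes_quant. Qed.

Lemma pi1_prenexes (V : Type) (f g : formula A V) : prenexes f g -> pi1 g -> pi1 f.
Proof. by move=> fg [h gh hP]; exists h => //; exact: prenexes_trans gh. Qed.

Lemma sigma2_prenexes (V : Type) (f g : formula A V) : prenexes f g -> sigma2 g -> sigma2 f.
Proof. by move=> fg [h gh hP]; exists h => //; exact: prenexes_trans gh. Qed.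

Lemma prenexes1 (V : Type) (f g : formula A V) : prenex_step f g -> prenexes f g.
Proof. exact/prenexes_step/prenexes_refl. Qed.

(** The type of variables grows under a quantifier, so induction on the prefix calls for a [P] that
    ranges over all [V]. *)
Lemma prenex_forall_ind (P : forall V, formula A V -> Prop) :
  (forall V (f : formula A V), quantifier_free f -> P V f) ->
  (forall V (f : formula A (option V)), prenex_forall f -> P _ f -> P V (Quant Forall f)) ->
  forall (V : Type) (f : formula A V), prenex_forall f -> P V f.
Proof.
move=> qfP allP V f; elim: V / f => //= V; try by move=> *; exact: qfP.
by case=> // f IH fP; apply: allP => //; exact: IH.
Qed.

Lemma prenex_sigma2_ind (P : forall V, formula A V -> Prop) :
  (forall V (f : formula A V), prenex_forall f -> P V f) ->
  (forall V (f : formula A (option V)), prenex_sigma2 f -> P _ f -> P V (Quant Exists f)) ->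
  forall (V : Type) (f : formula A V), prenex_sigma2 f -> P V f.
Proof.
move=> allP exP V f; elim: V / f => //= V; try by move=> *; exact: allP.
by case=> f IH fP; [apply: exP => //; exact: IH | exact: allP].
Qed.

Lemma pi1_conn (V : Type) c (f g : formula A V) : pi1 f -> pi1 g -> pi1 (Conn c f g).
Proof.
move=> [f' ff' f'P] [g' gg' g'P]; apply: pi1_prenexes (prenexes_conn c ff' gg') _.
move=> {f g ff' gg'}; move: V f' f'P g' g'P.
apply: prenex_forall_ind => V f fP; last first.
  move=> IH g gP; apply: (pi1_prenexes (prenexes1 (prenex_connl _ _ _ _))).
  by apply/pi1_forall/IH; rewrite prenex_forall_rename.
move=> g gP; move: V g gP f fP; apply: prenex_forall_ind => V g gP.
  by move=> f fP; apply: quantifier_free_pi1; rewrite /= fP.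
move=> IH f fP; apply: (pi1_prenexes (prenexes1 (prenex_connr _ _ _ _))).
by apply/pi1_forall/IH; rewrite quantifier_free_rename.
Qed.

(** The existential quantifiers of both operands are pulled out before any universal one, so that
    the prefix keeps two blocks; the universal rest is [pi1_conn]. *)
Lemma sigma2_conn (V : Type) c (f g : formula A V) : sigma2 f -> sigma2 g -> sigma2 (Conn c f g).
Proof.
move=> [f' ff' f'P] [g' gg' g'P]; apply: sigma2_prenexes (prenexes_conn c ff' gg') _.
move=> {f g ff' gg'}; move: V f' f'P g' g'P.
apply: prenex_sigma2_ind => V f fP; last first.
  move=> IH g gP; apply: (sigma2_prenexes (prenexes1 (prenex_connl _ _ _ _))).
  by apply/sigma2_exists/IH; rewrite prenex_sigma2_rename.
move=> g gP; move: V g gP f fP; apply: prenex_sigma2_ind => V g gP.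
  move=> f fP; apply/pi1_sigma2/pi1_conn; [exists f | exists g] => //; exact: prenexes_refl.
move=> IH f fP; apply: (sigma2_prenexes (prenexes1 (prenex_connr _ _ _ _))).
by apply/sigma2_exists/IH; rewrite prenex_forall_rename.
Qed.
End Prenex.

(** * Formulas that express the game, and the Ehrenfeucht-Fraïssé theorem *)

Section Characteristic.
Variable A : finType.
Local Notation plain := (@pred0 A).

Fixpoint splits (u : seq A) : seq (seq A * A * seq A) :=
  if u is a :: u' then ([::], a, u') :: [seq (a :: s.1.1, s.1.2, s.2) | s <- splits u']
  else [::].

Lemma splitsP (u : seq A) s : (s \in splits u) = (u == s.1.1 ++ s.1.2 :: s.2).
Proof.
elim: u s => [|a u IH] [[x b] y] /=; first by case: x.
rewrite inE; case: x => [|c x] /=.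
  rewrite eqseq_cons !xpair_eqE /= orb_idr; first by rewrite eq_sym [y == _]eq_sym.
  by case/mapP=> -[[? ?] ?] _ [].
rewrite eqseq_cons; apply/mapP/andP.
  by case=> -[[x' b'] y']; rewrite IH /= => /eqP-> [-> -> -> ->]; rewrite !eqxx.
by case=> /eqP-> def_u; exists (x, b, y) => //; rewrite IH.
Qed.

Definition truth (V : Type) : formula A V := Neg Falsum.
Definition bigor (V : Type) (s : seq (formula A V)) := foldr (Conn Or) Falsum s.
Definition bigand (V : Type) (s : seq (formula A V)) := foldr (Conn And) (truth V) s.

Definition between (V : Type) (lo hi : option V) : formula A (option V) :=
  Conn And (if lo is Some x then Less (Some x) None else truth _)
           (if hi is Some y then Less None (Some y) else truth _).

(* [game1_formula k u lo hi] says that Duplicator wins [game1 k] from the segment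
   strictly between [lo] and [hi] (a missing bound is an end of the word) to [u],
   and [game2_formula k u lo hi] that she wins [game2 k] from [u] to it. *)
Fixpoint game1_formula k u (V : Type) (lo hi : option V) : formula A V :=
  if k is k'.+1 then
    Quant Forall (Conn Or (Neg (between lo hi)) (bigor
      [seq Conn And (Label s.1.2 None)
             (Conn And (game1_formula k' s.1.1 (omap Some lo) (Some None))
                       (game1_formula k' s.2 (Some None) (omap Some hi))) | s <- splits u]))
  else truth V.

Fixpoint game2_formula k u (V : Type) (lo hi : option V) : formula A V :=
  if k is k'.+1 then
    Conn And (bigand [seq Quant Exists (Conn And (between lo hi) (Conn And (Label s.1.2 None)
             (Conn And (game2_formula k' s.1.1 (omap Some lo) (Some None))
                       (game2_formula k' s.2 (Some None) (omap Some hi))))) | s <- splits u])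
      (game1_formula k u lo hi)
  else truth V.

Lemma bigor_pi1 (V : Type) (T : eqType) (F : T -> formula A V) s :
  (forall t, pi1 (F t)) -> pi1 (bigor [seq F t | t <- s]).
Proof.
by move=> FP; elim: s => [|t s IH] /=; [exact: quantifier_free_pi1 | exact: pi1_conn].
Qed.

Lemma bigand_sigma2 (V : Type) (T : eqType) (F : T -> formula A V) s :
  (forall t, sigma2 (F t)) -> sigma2 (bigand [seq F t | t <- s]).
Proof.
move=> FP; elim: s => [|t s IH] /=; last exact: sigma2_conn.
exact/pi1_sigma2/quantifier_free_pi1.
Qed.

Lemma quantifier_free_between (V : Type) (lo hi : option V) : quantifier_free (between lo hi).
Proof. by case: lo; case: hi. Qed.

Lemma qrank_between (V : Type) (lo hi : option V) : qrank (between lo hi) = 0.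
Proof. by case: lo; case: hi. Qed.

Lemma game1_formula_pi1 k u (V : Type) (lo hi : option V) : pi1 (game1_formula k u lo hi).
Proof.
elim: k u V lo hi => [|k IH] u V lo hi /=; first exact: quantifier_free_pi1.
apply: pi1_forall; apply: pi1_conn; first exact/quantifier_free_pi1/quantifier_free_between.
apply: bigor_pi1 => s; apply: pi1_conn; first exact: quantifier_free_pi1.
exact: pi1_conn.
Qed.

Lemma game2_formula_sigma2 k u (V : Type) (lo hi : option V) :
  sigma2 (game2_formula k u lo hi).
Proof.
elim: k u V lo hi => [|k IH] u V lo hi; first exact/pi1_sigma2/quantifier_free_pi1.
apply: sigma2_conn; last exact/pi1_sigma2/game1_formula_pi1.
apply: bigand_sigma2 => s; apply: sigma2_exists; apply: sigma2_conn.
  exact/pi1_sigma2/quantifier_free_pi1/quantifier_free_between.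
by apply: sigma2_conn; [exact/pi1_sigma2/quantifier_free_pi1 | exact: sigma2_conn].
Qed.

Lemma qrank_conn (V : Type) c (f g : formula A V) k :
  qrank f <= k -> qrank g <= k -> qrank (Conn c f g) <= k.
Proof. by rewrite /= geq_max => -> ->. Qed.

Lemma qrank_quant (V : Type) q (f : formula A (option V)) k :
  qrank f <= k -> qrank (Quant q f) <= k.+1.
Proof. by []. Qed.

Lemma qrank_bigor (V : Type) (T : eqType) (F : T -> formula A V) s k :
  (forall t, qrank (F t) <= k) -> qrank (bigor [seq F t | t <- s]) <= k.
Proof. by move=> Fk; elim: s => //= t s IH; rewrite geq_max Fk. Qed.

Lemma qrank_bigand (V : Type) (T : eqType) (F : T -> formula A V) s k :
  (forall t, qrank (F t) <= k) -> qrank (bigand [seq F t | t <- s]) <= k.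
Proof. by move=> Fk; elim: s => //= t s IH; rewrite geq_max Fk. Qed.

Lemma qrank_game1_formula k u (V : Type) (lo hi : option V) :
  qrank (game1_formula k u lo hi) <= k.
Proof.
elim: k u V lo hi => [|k IH] u V lo hi //.
apply: (@qrank_quant _ Forall); apply: qrank_conn; first by rewrite [qrank _](qrank_between lo hi).
by apply: qrank_bigor => s; do !apply: qrank_conn.
Qed.

Lemma qrank_game2_formula k u (V : Type) (lo hi : option V) :
  qrank (game2_formula k u lo hi) <= k.
Proof.
elim: k u V lo hi => [|k IH] u V lo hi //.
apply: qrank_conn; last exact: qrank_game1_formula.
apply: qrank_bigand => s; apply: qrank_quant.
by apply: qrank_conn; [rewrite qrank_between | do !apply: qrank_conn].
Qed.

Definition segment (w : seq A) l h := drop l (take h w).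

Lemma segment_mid w (i : 'I_(size w)) l h : l <= i < h ->
  segment w l h = segment w l i ++ tnth (in_tuple w) i :: segment w i.+1 h.
Proof.
move=> /andP[li ih]; rewrite /segment (tnth_nth (tnth (in_tuple w) i)) /=.
set a := tnth _ _; have szi : size (take i w) = i by rewrite size_takel // ltnW.
have takeE : take h w = take i w ++ nth a w i :: drop i.+1 (take h w).
  rewrite -{1}(cat_take_drop i (take h w)) take_takel; last exact: ltnW.
  rewrite (drop_nth a); last by rewrite size_take; case: ifP.
  by rewrite nth_take.
rewrite [in LHS]takeE drop_cat szi; case: ltngtP li => // -> _.
by rewrite subnn drop0 [drop i (take i w)]drop_oversize ?szi.
Qed.

Lemma segment_cat w l h x a y : h <= size w -> segment w l h = x ++ a :: y ->
  exists i : 'I_(size w), [/\ l <= i < h, tnth (in_tuple w) i = a,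
    segment w l i = x & segment w i.+1 h = y].
Proof.
move=> le_h def_s.
have sz : size (segment w l h) = h - l by rewrite size_drop size_takel.
have lt_x : size x < h - l by rewrite -sz def_s size_cat /= addnS ltnS leq_addr.
have lt_i : l + size x < size w by lia.
exists (Ordinal lt_i); have mid := @segment_mid w (Ordinal lt_i) l h.
have in_lh : l <= Ordinal lt_i < h by rewrite /=; lia.
move: (mid in_lh); rewrite def_s => /eqP.
rewrite eqseq_cat; last by rewrite size_drop size_takel /=; lia.
by case/andP=> /eqP<- /eqP[<- <-].
Qed.

(** The bounds follow the half-open convention of [segment]: the successor skips the pebble at the
    left end, and the right end is excluded as it stands. *)
Definition lower (V : Type) (w : seq A) (e : V -> 'I_(size w)) (lo : option V) :=
  if lo is Some x then (e x).+1 else 0.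
Definition upper (V : Type) (w : seq A) (e : V -> 'I_(size w)) (hi : option V) :=
  if hi is Some y then e y : nat else size w.

Lemma upper_le (V : Type) w (e : V -> 'I_(size w)) hi : upper e hi <= size w.
Proof. by case: hi => //= y; exact: ltnW. Qed.

Lemma holds_between (V : Type) w (e : V -> 'I_(size w)) lo hi i :
  holds (between lo hi) (fun x => oapp e i x) = (lower e lo <= i < upper e hi).
Proof. by case: lo => [x|]; case: hi => [y|] //=; rewrite ?ltn_ord ?andbT. Qed.

Lemma holds_bigor (V : Type) (T : eqType) (F : T -> formula A V) s w (e : V -> 'I_(size w)) :
  holds (bigor [seq F t | t <- s]) e = has (fun t => holds (F t) e) s.
Proof. by elim: s => //= t s ->. Qed.

Lemma holds_bigand (V : Type) (T : eqType) (F : T -> formula A V) s w (e : V -> 'I_(size w)) :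
  holds (bigand [seq F t | t <- s]) e = all (fun t => holds (F t) e) s.
Proof. by elim: s => //= t s ->. Qed.

Lemma lower_Some (V : Type) w (e : V -> 'I_(size w)) i lo :
  lower (fun x => oapp e i x) (omap Some lo) = lower e lo.
Proof. by case: lo. Qed.
Lemma upper_Some (V : Type) w (e : V -> 'I_(size w)) i hi :
  upper (fun x => oapp e i x) (omap Some hi) = upper e hi.
Proof. by case: hi. Qed.

Lemma filter_plain (u : seq A) : filter plain u = [::].
Proof. exact: filter_pred0. Qed.

Lemma holds_or (V : Type) (f g : formula A V) w (e : V -> 'I_(size w)) :
  holds (Conn Or f g) e = holds f e || holds g e.
Proof. by []. Qed.
Lemma holds_and (V : Type) (f g : formula A V) w (e : V -> 'I_(size w)) :
  holds (Conn And f g) e = holds f e && holds g e.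
Proof. by []. Qed.
Lemma holds_neg (V : Type) (f : formula A V) w (e : V -> 'I_(size w)) :
  holds (Neg f) e = ~~ holds f e.
Proof. by []. Qed.
Lemma holds_label (V : Type) (a : A) x w (e : V -> 'I_(size w)) :
  holds (Label a x) e = (tnth (in_tuple w) (e x) == a).
Proof. by []. Qed.
Lemma holds_forall (V : Type) (f : formula A (option V)) w (e : V -> 'I_(size w)) :
  holds (Quant Forall f) e = [forall i, holds f (fun x => oapp e i x)].
Proof. by []. Qed.
Lemma holds_exists (V : Type) (f : formula A (option V)) w (e : V -> 'I_(size w)) :
  holds (Quant Exists f) e = [exists i, holds f (fun x => oapp e i x)].
Proof. by []. Qed.
Definition holdsE := (holds_or, holds_and, holds_neg, holds_label, holds_between,
  holds_bigor, holds_bigand).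

Lemma game1_formulaS k u (V : Type) (lo hi : option V) : game1_formula k.+1 u lo hi =
  Quant Forall (Conn Or (Neg (between lo hi)) (bigor
    [seq Conn And (Label s.1.2 None)
           (Conn And (game1_formula k s.1.1 (omap Some lo) (Some None))
                     (game1_formula k s.2 (Some None) (omap Some hi))) | s <- splits u])).
Proof. by []. Qed.

Lemma game2_formulaS k u (V : Type) (lo hi : option V) : game2_formula k.+1 u lo hi =
  Conn And (bigand [seq Quant Exists (Conn And (between lo hi) (Conn And (Label s.1.2 None)
           (Conn And (game2_formula k s.1.1 (omap Some lo) (Some None))
                     (game2_formula k s.2 (Some None) (omap Some hi))))) | s <- splits u])
    (game1_formula k.+1 u lo hi).
Proof. by []. Qed.

Lemma holds_game1_formula k u (V : Type) (lo hi : option V) w (e : V -> 'I_(size w)) :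
  holds (game1_formula k u lo hi) e <->
  game1 plain k (segment w (lower e lo) (upper e hi)) u.
Proof.
elim: k u V lo hi e => [|k IH] u V lo hi e; first by rewrite /= !filter_plain.
have IHs (s : seq A * A * seq A) (i : 'I_(size w)) :
    holds (game1_formula k s.1.1 (omap Some lo) (Some None)) (fun x => oapp e i x) &&
    holds (game1_formula k s.2 (Some None) (omap Some hi)) (fun x => oapp e i x) <->
    game1 plain k (segment w (lower e lo) i) s.1.1 /\
    game1 plain k (segment w i.+1 (upper e hi)) s.2.
  rewrite -{1}(lower_Some e i) -(upper_Some e i).
  by split=> [/andP[/IH ? /IH ?]|[? ?]] //; apply/andP; split; apply/IH.
rewrite game1_formulaS holds_forall; split.
  move=> /forallP H; split; first by rewrite !filter_plain.
  move=> x a y def_s; have [i [lhi <- <- <-]] := segment_cat (upper_le _ _) def_s.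
  move: (H i); rewrite !holdsE lhi /= => /hasP[s].
  rewrite splitsP => /eqP def_u /andP[/eqP def_a /IHs[G1 G2]].
  by exists s.1.1, s.2; rewrite def_u -def_a.
case=> _ F; apply/forallP => i.
rewrite !holdsE -implybE; apply/implyP => lhi.
have [v1 [v2 [def_u G1 G2]]] := F _ _ _ (segment_mid lhi).
apply/hasP; exists (v1, tnth (in_tuple w) i, v2); first by rewrite splitsP def_u.
by rewrite ?holdsE /= eqxx; apply/(IHs (v1, tnth (in_tuple w) i, v2)).
Qed.

Lemma holds_game2_formula k u (V : Type) (lo hi : option V) w (e : V -> 'I_(size w)) :
  holds (game2_formula k u lo hi) e <->
  game2 plain k u (segment w (lower e lo) (upper e hi)).
Proof.
elim: k u V lo hi e => [|k IH] u V lo hi e; first by rewrite /= !filter_plain.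
have IHs (s : seq A * A * seq A) (i : 'I_(size w)) :
    holds (game2_formula k s.1.1 (omap Some lo) (Some None)) (fun x => oapp e i x) &&
    holds (game2_formula k s.2 (Some None) (omap Some hi)) (fun x => oapp e i x) <->
    game2 plain k s.1.1 (segment w (lower e lo) i) /\
    game2 plain k s.2 (segment w i.+1 (upper e hi)).
  rewrite -{1}(lower_Some e i) -(upper_Some e i).
  by split=> [/andP[/IH ? /IH ?]|[? ?]] //; apply/andP; split; apply/IH.
(* The backward half of [game2] is the forward half of [game1] with the words exchanged and the same
   number of rounds. *)
have back := holds_game1_formula k.+1 u lo hi e.
rewrite game2_formulaS holds_and holds_bigand; split.
  move=> /andP[/allP H /back[_ B]].
  split; first by rewrite !filter_plain.
  split=> // x a y def_u.
  have /H : (x, a, y) \in splits u by rewrite splitsP def_u.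
  rewrite holds_exists => /existsP[i]; rewrite !holdsE => /and3P[lhi /eqP def_a /IHs[G1 G2]].
  rewrite /= in def_a; exists (segment w (lower e lo) i), (segment w i.+1 (upper e hi)).
  by rewrite -def_a -segment_mid.
case=> _ [F B]; apply/andP; split; last by apply/back; split=> //; rewrite !filter_plain.
apply/allP => s; rewrite splitsP => /eqP def_u.
have [v1 [v2 [def_s G1 G2]]] := F _ _ _ def_u.
have [i [lhi def_a def_v1 def_v2]] := segment_cat (upper_le _ _) def_s.
rewrite holds_exists; apply/existsP; exists i.
rewrite !holdsE lhi /= def_a eqxx /=.
by apply/IHs; rewrite def_v1 def_v2.
Qed.

(** From left to right, [u] satisfies its own formula [game2_formula k u], which is $\Sigma_2$ of
    rank at most [k], and so [v] satisfies it. From right to left, [game_holds] applies to any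
    formula of the right shape. *)
Theorem lesssim2P k u v : lesssim2 k u v <-> game2 plain k u v.
Proof.
split=> [/asboolP uv|G].
  pose f := game2_formula k u (None : option void) None.
  have full w : segment w (lower (@of_void 'I_(size w)) None) (upper (@of_void 'I_(size w)) None) = w.
    by rewrite /segment /= drop0 take_size.
  have [G _] := holds_game2_formula k u None None (@of_void 'I_(size v)).
  rewrite full in G; apply/G/uv; [exact: game2_formula_sigma2 | exact: qrank_game2_formula |].
  by apply/holds_game2_formula; rewrite full; exact: game2_refl.
apply/asboolP => f /sigma2_shape2 fS le_k; rewrite /satisfies.
have [_ _ S2 _] := game_holds (@of_void 'I_(size u)) (@of_void 'I_(size v)) le_k.
apply: S2 => //; rewrite /positions.
(* A sentence has no free variable, so its decorated words carry no pebble. *)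
have decorE w (e : void -> nat) : decor 0 e w = map (fun a => (a, @of_void bool)) w.
  elim: w 0 => //= a w IH n; rewrite IH; congr (_ :: _); congr (_, _).
  by apply/funext => -[].
rewrite !decorE; apply: (game_map _ k u v).2 G => a.
by apply/asboolP => -[[]].
Qed.
End Characteristic.

(** * Finite monoids and factorization forests *)

Section FiniteMonoid.
Local Open Scope group_scope.
Variable S : finMonoidType.
Implicit Types a b x y e f : S.

Lemma expg_ultimately_periodic x : exists i p, x ^+ (i + p.+1) = x ^+ i.
Proof.
pose g (i : 'I_#|S|.+1) := x ^+ i.
have : ~ injective g.
  by move=> /leq_card; rewrite card_ord ltnn.
case/existsNP => i /existsNP[j /not_implyP[eq_ij neq_ij]].
wlog lt_ij : i j eq_ij neq_ij / (i < j)%N.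
  move=> W; have [lt_ij|lt_ji|/val_inj//] := ltngtP i j; first exact: (W i j).
  by apply: (W j i) => // /esym.
exists i, (j - i).-1; rewrite (_ : i + _ = j)%N; first exact/esym.
by lia.
Qed.

Lemma idempotent_power x : exists m, x ^+ m.+1 * x ^+ m.+1 = x ^+ m.+1.
Proof.
have [i [p xip]] := expg_ultimately_periodic x.
have periodic j q : (i <= j)%N -> x ^+ (j + q * p.+1) = x ^+ j.
  move=> le_ij; elim: q => [|q IHq]; first by rewrite addn0.
  rewrite -[RHS]IHq (_ : j + q.+1 * p.+1 = (j - i + q * p.+1) + (i + p.+1))%N; last by nia.
  by rewrite expgnDr xip -expgnDr; congr natexp; lia.
(* A positive multiple of the period [p.+1] that is not below the preperiod [i]. *)
exists (i.+1 * p.+1).-1; rewrite prednK // -expgnDr.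
by apply: periodic; nia.
Qed.

(** Iteration gives [x = a ^+ n * x * b ^+ n]. For [n] in the periodic range of the powers of [b],
    one more period on the right changes nothing. *)
Lemma sandwich_stable a x b : x = a * x * b -> exists m, x = x * b ^+ m.+1.
Proof.
move=> xE; have [i [p bip]] := expg_ultimately_periodic b.
have xEn n : x = a ^+ n * x * b ^+ n.
  elim: n => [|n IHn]; first by rewrite !expg0 mul1g mulg1.
  by rewrite {1}IHn {1}xE expgSr expgS !mulgA.
exists p; rewrite {2}(xEn i) -mulgA -expgnDr.
by rewrite bip -xEn.
Qed.

Lemma sandwich_stable_l a x b : x = a * x * b -> exists m, x = a ^+ m.+1 * x.
Proof.
move=> xE; have [i [p aip]] := expg_ultimately_periodic a.
have xEn n : x = a ^+ n * x * b ^+ n.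
  elim: n => [|n IHn]; first by rewrite !expg0 mul1g mulg1.
  by rewrite {1}IHn {1}xE expgSr expgS !mulgA.
exists p; rewrite {2}(xEn i) !mulgA -expgnDr addnC.
by rewrite aip -xEn.
Qed.

End FiniteMonoid.

(** * Factorization forests for an abstract cover relation *)

Section Forest.
Local Open Scope group_scope.
Variables (A : eqType) (S : finMonoidType).
(** [Bd h w x] stands for [x] covering [w] at height [h], which keeps the section free of logic; the
    instance is [covers]. *)
Variable Bd : nat -> seq A -> S -> Prop.
Hypothesis Bd_mono : forall h h' w x, (h <= h')%N -> Bd h w x -> Bd h' w x.
Hypothesis Bd_nil : Bd 0 [::] 1.
Hypothesis Bd_cat : forall h u v x y, Bd h u x -> Bd h v y -> Bd h.+1 (u ++ v) (x * y).
Hypothesis Bd_idem : forall h e us, e * e = e -> us != [::] ->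
  {in us, forall u, Bd h u e} ->
  exists f, [/\ Bd h.+2 (flatten us) f, e * f = f, f * e = f & f * f = f].

Implicit Types (l : seq (seq A * S)) (bls : seq (seq (seq A * S))).

(** A list of pairs is a factorization of a word, in which each factor comes with a value meant to
    cover it. *)
Definition word l := flatten [seq it.1 | it <- l].
Definition value l : S := \big[*%g/1]_(it <- l) it.2.

Lemma word_cat l1 l2 : word (l1 ++ l2) = word l1 ++ word l2.
Proof. by rewrite /word map_cat flatten_cat. Qed.
Lemma value_cat l1 l2 : value (l1 ++ l2) = value l1 * value l2.
Proof. by rewrite /value big_cat. Qed.
Lemma value_cons it l : value (it :: l) = it.2 * value l.
Proof. by rewrite /value big_cons. Qed.
Lemma word_cons it l : word (it :: l) = it.1 ++ word l.
Proof. by []. Qed.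
Lemma value_nil : value [::] = 1.
Proof. by rewrite /value big_nil. Qed.
Lemma value_seq1 it : value [:: it] = it.2.
Proof. by rewrite value_cons value_nil mulg1. Qed.
Lemma word_seq1 it : word [:: it] = it.1.
Proof. by rewrite word_cons cats0. Qed.

(** Turns a block into a single item of a coarser factorization. *)
Definition block_item l := (word l, value l).

Lemma word_merge bls : word (map block_item bls) = word (flatten bls).
Proof. by elim: bls => //= b bls IH; rewrite word_cons word_cat IH. Qed.
Lemma value_merge bls : value (map block_item bls) = value (flatten bls).
Proof. by elim: bls => //= b bls IH; rewrite value_cons value_cat IH. Qed.

Lemma Bd_cat2 h k u v x y : (h < k)%N -> Bd h u x -> Bd k.-1 v y -> Bd k (u ++ v) (x * y).
Proof.
case: k => // k /= hk Bu Bv; apply: Bd_cat => //.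
by apply: Bd_mono Bu.
Qed.

Definition bounded h l := forall it, it \in l -> Bd h it.1 it.2.

Lemma bounded_cat h l1 l2 : bounded h (l1 ++ l2) <-> bounded h l1 /\ bounded h l2.
Proof.
split=> [B|[B1 B2] it]; last by rewrite mem_cat => /orP[/B1|/B2].
by split=> it it_l; apply: B; rewrite mem_cat it_l ?orbT.
Qed.

(** * Factorizations whose covers stay in one J-class *)

Section Class.
(* [J] is a J-class (in the sense of Green) that is maximal in the ideal [I]. *)
Variables (I J : {set S}).
Hypothesis I_ideal : forall a x b, x \in I -> a * x * b \in I.
Hypothesis J_in_I : forall x, x \in J -> x \in I.
Hypothesis J_up : forall x a b, x \in I -> a * x * b \in J -> x \in J.
Hypothesis J_class : forall x y, x \in J -> y \in J -> exists a b, x = a * y * b.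

Lemma I_l a x : x \in I -> a * x \in I.
Proof. by rewrite -[X in _ -> X \in _]mulg1; exact: I_ideal. Qed.
Lemma I_r x a : x \in I -> x * a \in I.
Proof. by rewrite -[X in _ -> X * _ \in _]mul1g; exact: I_ideal. Qed.
Lemma J_up_l a x : x \in I -> a * x \in J -> x \in J.
Proof. by move=> xI axJ; apply: (@J_up x a 1); rewrite ?mulg1. Qed.
Lemma J_up_r x a : x \in I -> x * a \in J -> x \in J.
Proof. by move=> xI xaJ; apply: (@J_up x 1 a); rewrite ?mul1g. Qed.

(** Stability of finite monoids: [x = c * x * (a * d)] yields [x = x * (a * d) ^+ m.+1], and the
    right side starts with [x * a]. *)
Lemma J_right x a : x \in J -> x * a \in J -> exists b, x = x * a * b.
Proof.
move=> xJ xaJ; have [c [d]] := J_class xJ xaJ.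
rewrite -!mulgA mulgA [a * d]lock => /sandwich_stable[m].
rewrite -lock expgS => xE; exists (d * (a * d) ^+ m).
by rewrite -!mulgA in xE *.
Qed.

Lemma J_left a x : x \in J -> a * x \in J -> exists b, x = b * a * x.
Proof.
move=> xJ axJ; have [c [d]] := J_class xJ axJ.
rewrite mulgA => /sandwich_stable_l[m].
rewrite expgSr => xE; exists ((c * a) ^+ m * c).
by rewrite -!mulgA in xE *.
Qed.

Variable K : nat.

(* For such a sequence the value of every cover built below stays in [J], which
   forces it to be the exact product. *)
Definition nolow l := forall l1 l2 l3, l = l1 ++ l2 ++ l3 -> l2 != [::] ->
  forall z, Bd K (word l2) z -> z \in I -> z \in J.

Lemma nolow_factor l1 l2 l3 : nolow (l1 ++ l2 ++ l3) -> nolow l2.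
Proof.
move=> N m1 m2 m3 eq_l2 m2_nil z; apply: (N (l1 ++ m1) m2 (m3 ++ l3)) => //.
by rewrite eq_l2 -!catA.
Qed.
Lemma nolow_prefix l2 l3 : nolow (l2 ++ l3) -> nolow l2.
Proof. exact: (@nolow_factor [::]). Qed.
Lemma nolow_suffix l1 l2 : nolow (l1 ++ l2) -> nolow l2.
Proof. by rewrite -{1}[l2]cats0; exact: nolow_factor. Qed.

(** A run of merged blocks is a run of the original items. The blocks have to be nonempty for a
    nonempty run of blocks to be a nonempty run of items. *)
Lemma nolow_merge bls : [::] \notin bls -> nolow (flatten bls) -> nolow (map block_item bls).
Proof.
move=> bls_nil N l1 l2 l3 eq_l l2_nil z.
have [m1 [m2 [m3 [def_bls def_l2]]]] :
    exists m1 m2 m3, bls = m1 ++ m2 ++ m3 /\ l2 = map block_item m2.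
  pose j := size l2.
  exists (take (size l1) bls), (take j (drop (size l1) bls)), (drop j (drop (size l1) bls)).
  rewrite !cat_take_drop; split=> //.
  by rewrite map_take map_drop eq_l drop_size_cat // take_size_cat.
rewrite def_l2 word_merge; apply: (N (flatten m1) _ (flatten m3)).
  by rewrite def_bls !flatten_cat.
move: l2_nil bls_nil; rewrite def_l2 def_bls; case: m2 {def_bls def_l2} => // b m2 _.
by rewrite !mem_cat inE; case: b => //; rewrite eqxx orbT.
Qed.

Section Level.
Variable h : nat.
Hypothesis h_lt_K : (h < K)%N.

Lemma nolow_item it l : nolow l -> bounded h l -> (forall it, it \in l -> it.2 \in I) ->
  it \in l -> it.2 \in J.
Proof.
move=> N B lI it_l; have /path.splitPr def_l := it_l; case: def_l N B lI it_l => l1 l2 N B lI it_l.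
apply: (N l1 [:: it] l2) => //; last exact: lI.
by rewrite word_seq1; apply: Bd_mono (ltnW h_lt_K) _; exact: B.
Qed.

(** The product of two neighbours covers their factor at height [h.+1], hence lies in [J]. By
    stability the first item of the tail is a right multiple of the value of the tail, so that the
    product of [it] with the whole tail lies above such a neighbour product. *)
Lemma nolow_value l : nolow l -> bounded h l -> (forall it, it \in l -> it.2 \in I) ->
  l != [::] -> value l \in J.
Proof.
elim: l => // it [|it' l] IH N B lI _.
  by rewrite value_seq1; apply: nolow_item N B lI _; rewrite mem_head.
have N' : nolow (it' :: l) by apply: (@nolow_suffix [:: it]).
have v'J : value (it' :: l) \in J.
  apply: IH => // [j jl|j jl]; [apply: B | apply: lI]; by rewrite inE jl orbT.
have itJ : it.2 \in J by apply: nolow_item N B lI _; rewrite mem_head.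
have it'J : it'.2 \in J by apply: nolow_item N B lI _; rewrite !inE eqxx orbT.
have pairJ : it.2 * it'.2 \in J.
  apply: (N [::] [:: it; it'] l) => //; last exact/I_r/J_in_I.
  rewrite word_cons word_seq1; apply: (@Bd_mono h.+1) => //.
  by apply: Bd_cat; apply: B; rewrite !inE eqxx ?orbT.
rewrite value_cons.
move: v'J; rewrite value_cons => v'J; have [c it'E] := J_right it'J v'J.
rewrite it'E mulgA in pairJ.
by apply: J_up_r pairJ; apply/I_l/J_in_I.
Qed.
End Level.

Lemma first_hit (q v : S) l :
  (forall l1 l2, l = l1 ++ l2 -> l1 != [::] -> q * value l1 != v) \/
  exists l0 it l', [/\ l = rcons l0 it ++ l', q * value (rcons l0 it) = v &
    forall l1 l2, l0 = l1 ++ l2 -> l1 != [::] -> q * value l1 != v].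
Proof.
elim: l q => [|it l IH] q; first by left => -[].
have [hit|nhit] := eqVneq (q * it.2) v.
  by right; exists [::], it, l; split=> //; [rewrite value_seq1 | case].
have [nohit|[l0 [jt [l' [-> hit nohit]]]]] := IH (q * it.2).
  left => -[//|it' l1] l2 [<- def_l] _; rewrite value_cons mulgA.
  case: l1 def_l => [|j l1] def_l; first by rewrite value_nil mulg1.
  exact: (nohit (j :: l1) l2).
right; exists (it :: l0), jt, l'; split=> //.
  by rewrite value_cons mulgA.
move=> [//|it' l1] l2 [<- def_l] _; rewrite value_cons mulgA.
case: l1 def_l => [|j l1] def_l; first by rewrite value_nil mulg1.
exact: (nohit (j :: l1) l2).
Qed.

(** A first return to [v] in the right Cayley graph. *)
Definition return_word (v : S) z := exists l0 it, [/\ z = rcons l0 it, v * value z = v &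
  forall l1 l2, l0 = l1 ++ l2 -> l1 != [::] -> v * value l1 != v].

Lemma return_decomposition (v : S) l : exists zs post, [/\ l = flatten zs ++ post,
  forall z, z \in zs -> return_word v z &
  forall l1 l2, post = l1 ++ l2 -> l1 != [::] -> v * value l1 != v].
Proof.
have [n] := ubnP (size l); elim: n l => // n IH l.
have [nohit _|[l0 [it [l' [-> hit nohit]]]]] := first_hit v v l.
  by exists [::], l; split.
rewrite size_cat size_rcons => lt_n.
have [|zs [post [-> zsP postP]]] := IH l'; first by lia.
exists (rcons l0 it :: zs), post; split=> //=; first by rewrite catA.
by move=> z; rewrite inE => /orP[/eqP->|/zsP//]; exists l0, it.
Qed.

Lemma value_returns (v : S) zs : (forall z, z \in zs -> return_word v z) ->
  v * value (flatten zs) = v.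
Proof.
elim: zs => [_|z zs IH zsP]; first by rewrite value_nil mulg1.
rewrite /= value_cat mulgA; have [|l0 [it [_ -> _]]] := zsP z; first exact: mem_head.
by apply: IH => y y_zs; apply: zsP; rewrite inE y_zs orbT.
Qed.

Lemma value_idempotents (e : S) bls : e * e = e -> bls != [::] ->
  (forall b, b \in bls -> value b = e) -> value (flatten bls) = e.
Proof.
move=> ee; elim: bls => // b [|b' bls] IH _ blsP.
  by rewrite /= cats0; apply: blsP; rewrite mem_head.
rewrite /= value_cat (blsP b) ?mem_head// [X in e * X]IH // => c cb.
by apply: blsP; rewrite inE cb orbT.
Qed.

(** * Factorizations whose items lie in one R-class [r] *)

Section RClass.
Variable r : {set S}.
Hypothesis r_in_J : forall x, x \in r -> x \in J.
Hypothesis r_closed : forall x a, x \in r -> x * a \in J -> x * a \in r.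
Hypothesis r_class : forall x y, x \in r -> y \in r -> exists c, y = x * c.

(** As [v * z] stays in [J], the left factor [v] can be undone: [z = b * v], whence
    [z * z = b * v * z = b * v = z]. *)
Lemma return_idempotent v z : v \in J -> z \in J -> v * z = v -> z * z = z.
Proof.
move=> vJ zJ vz; have [|b] := @J_left v z zJ; first by rewrite vz.
by rewrite -mulgA vz => zE; rewrite {1}zE -mulgA vz.
Qed.

(** From [z = b * v] follows [z * y = z]. From [y = z * c] and the idempotence of [z] follows
    [z * y = y]. *)
Lemma return_unique v z y : v \in J -> z \in r -> y \in r ->
  v * z = v -> v * y = v -> z = y.
Proof.
move=> vJ zr yr vz vy.
have zz := return_idempotent vJ (r_in_J zr) vz.
have [c yE] := r_class zr yr.
have [|b] := @J_left v z (r_in_J zr); first by rewrite vz.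
rewrite -mulgA vz => zE.
have zy : z * y = z by rewrite zE -mulgA vy.
by rewrite -zy {1}yE mulgA zz -yE.
Qed.

(** Induction on the set [P] of values that the prefix products [q * value l1] may take. With [v]
    the last of them, [l] is cut at its visits to [v], so that one value less occurs inside each
    piece. All pieces after the first have the same idempotent value by [return_unique]. The cost
    per value is 1 for the last item of a piece, 2 for [Bd_idem] and 1 for attaching the first
    piece, which fits in 5. *)
Lemma Rclass_bound n (P : {set S}) h l q : #|P| = n -> P \subset J ->
  (h + 5 * n <= K)%N -> bounded h l -> nolow l ->
  (forall it, it \in l -> it.2 \in r) ->
  (forall l1 l2, l = l1 ++ l2 -> l1 != [::] -> q * value l1 \in P) ->
  Bd (h + 5 * n) (word l) (value l).
Proof.
elim: n P l q => [|n IH] P l q cardP PJ le_K B N lr lP.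
  case: l lP {B N lr} => [|it l] lP; first by rewrite value_nil; apply: Bd_mono Bd_nil.
  by have := lP [:: it] l erefl isT; rewrite (cards0_eq cardP) inE.
have [-> |l_nil] := eqVneq l [::].
  by rewrite value_nil; apply: Bd_mono Bd_nil.
pose v := q * value l.
have vP : v \in P by apply: (lP l [::]) => //; rewrite cats0.
have vJ : v \in J by exact: (fintype.subsetP PJ _ vP).
have cardP' : #|P :\ v| = n by move: (cardsD1 v P); rewrite vP cardP; lia.
have P'J : P :\ v \subset J by exact: fintype.subset_trans (finset.subD1set _ _) PJ.
have h_lt_K : (h < K)%N by lia.
pose h' := (h + 5 * n)%N.
have piece q0 l0 it : bounded h (rcons l0 it) -> nolow (rcons l0 it) ->
    (forall jt, jt \in rcons l0 it -> jt.2 \in r) ->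
    (forall l1 l2, l0 = l1 ++ l2 -> l1 != [::] -> q0 * value l1 \in P :\ v) ->
    Bd h'.+1 (word (rcons l0 it)) (value (rcons l0 it)).
  rewrite -cats1 => /bounded_cat[B0 Bit] N0 r0 P0; rewrite word_cat value_cat.
  apply: Bd_cat.
    apply: (IH (P :\ v) l0 q0) => //; first by lia.
      exact: nolow_prefix N0.
    by move=> jt jl; apply: r0; rewrite mem_cat jl.
  rewrite word_seq1 value_seq1; apply: (@Bd_mono h); first by rewrite /h'; lia.
  by apply: Bit; rewrite mem_head.
have [/(_ l [::])|] := first_hit q v l.
  by rewrite cats0 => /(_ erefl l_nil); rewrite eqxx.
case=> l0 [it [l' [def_l hit nohit]]].
have [zs [post [def_l' zsP postP]]] := return_decomposition v l'.
(* The walk through all of [l] ends at [v], so nothing remains after the last return. *)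
have vzs := value_returns zsP.
have post_nil : post = [::].
  apply/eqP; apply: contraT => post_nil.
  have := postP post [::]; rewrite cats0 => /(_ erefl post_nil) /eqP[].
  by rewrite -{1}vzs -mulgA -value_cat -def_l' -{1}hit -mulgA -value_cat -def_l.
rewrite post_nil cats0 {postP post_nil} in def_l'.
have Bpre : Bd h'.+1 (word (rcons l0 it)) (value (rcons l0 it)).
  apply: (@piece q).
  - by move: B; rewrite def_l => /bounded_cat[].
  - by move: N; rewrite def_l => /nolow_prefix.
  - by move=> jt jl; apply: lr; rewrite def_l mem_cat jl.
  - move=> l1 l2 def_l0 l1_nil; rewrite in_setD1 (nohit l1 l2) //=.
    apply: (lP l1 (rcons l2 it ++ l')) => //.
    by rewrite def_l def_l0 rcons_cat -catA.
have [zs_nil|zs_nil] := eqVneq zs [::].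
  rewrite def_l def_l' zs_nil cats0.
  by apply: Bd_mono Bpre; rewrite /h'; lia.
have zP z : z \in zs -> [/\ Bd h'.+1 (word z) (value z), value z \in r & v * value z = v].
  move=> z_zs; have [m0 [jt [def_z vz zhit]]] := zsP z z_zs.
  have /path.splitPr def_zs := z_zs.
  case: def_zs def_l' vzs zsP {z_zs zs_nil} => zs1 zs2 def_l' _ zsP.
  have Bz : bounded h z.
    by move: B; rewrite def_l def_l' flatten_cat => /bounded_cat[_ /bounded_cat[_ /bounded_cat[]]].
  have Nz : nolow z.
    by move: N; rewrite def_l def_l' flatten_cat catA => /nolow_factor.
  have rz jt' : jt' \in z -> jt'.2 \in r.
    by move=> jz; apply: lr; rewrite def_l def_l' flatten_cat !mem_cat jz !orbT.
  have zJ : value z \in J.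
    apply: (@nolow_value h) => //; last by rewrite def_z; case: (m0).
    by move=> i /rz /r_in_J /J_in_I.
  split=> //; last first.
    have: z != [::] by rewrite def_z; case: (m0).
    case: (z) zJ rz => // i z' zJ rz _.
    move: zJ; rewrite value_cons; apply: r_closed; apply: rz; exact: mem_head.
  rewrite def_z; apply: (@piece v); rewrite -?def_z //.
  move=> l1 l2 def_m0 l1_nil; rewrite in_setD1 (zhit l1 l2) //=.
  have vzs1 : v * value (flatten zs1) = v.
    by apply: value_returns => y yz; apply: zsP; rewrite mem_cat yz.
  rewrite -vzs1 -{1}hit -!mulgA -!value_cat.
  apply: (lP _ (rcons l2 jt ++ flatten zs2)).
    by rewrite def_l def_l' flatten_cat /= def_z def_m0 rcons_cat -!catA.
  by case: (l0).
case def_zs: zs zs_nil => [//|z0 zs'] _.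
have z0_zs : z0 \in zs by rewrite def_zs mem_head.
have [_ z0r vz0] := zP z0 z0_zs.
have ee := return_idempotent vJ (r_in_J z0r) vz0.
have zsE z : z \in zs -> value z = value z0.
  by move=> /zP[_ zr vz]; apply: return_unique vJ zr z0r vz vz0.
have zs_nil : zs != [::] by rewrite def_zs.
have flatE : flatten [seq word z | z <- zs] = word (flatten zs).
  by elim: (zs) => //= z zs1 ->; rewrite word_cat.
have [||F [BF eF Fe FF]] := @Bd_idem h'.+1 (value z0) [seq word z | z <- zs] ee.
- by rewrite def_zs.
- by move=> _ /mapP[z z_zs ->]; rewrite -(zsE z) //; case: (zP z).
(* [F] covers a factor of [l] and lies in [I] since [e * F = F], so [nolow] keeps it in [J]. *)
have FJ : F \in J.
  apply: (N (rcons l0 it) (flatten zs) [::]); first by rewrite cats0 def_l def_l'.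
  - rewrite def_zs /=; have [m0 [jt [-> _ _]]] := zsP z0 z0_zs.
    by case: (m0).
  - by rewrite -flatE; apply: Bd_mono BF; rewrite /h'; lia.
  - by rewrite -eF; apply/I_r/J_in_I/r_in_J.
(* An idempotent below [e] in the same J-class is [e]: from [e = F * b] follows
   [F = F * e = F * F * b = e]. *)
have FE : F = value z0.
  have [|b] := @J_right (value z0) F (r_in_J z0r); first by rewrite eF.
  by rewrite eF => z0E; rewrite -Fe [in LHS]z0E mulgA FF -z0E.
have flatV := value_idempotents ee zs_nil zsE.
rewrite def_l def_l' word_cat value_cat flatV.
apply: (@Bd_cat2 h'.+1); rewrite /h'; try lia; first exact: Bpre.
by rewrite -flatE -FE; apply: Bd_mono BF; rewrite /h'; lia.
Qed.
End RClass.

Lemma block_decomposition (r : {set S}) l : exists pre bls, [/\ l = pre ++ flatten bls,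
  forall it, it \in pre -> it.2 \notin r &
  forall b, b \in bls -> exists it rest, [/\ b = it :: rest, it.2 \in r &
    forall jt, jt \in rest -> jt.2 \notin r]].
Proof.
elim: l => [|it l [pre [bls [-> preP blsP]]]]; first by exists [::], [::].
have [it_r|it_r] := boolP (it.2 \in r).
  exists [::], ((it :: pre) :: bls); split=> // b; rewrite inE => /orP[/eqP->|/blsP//].
  by exists it, pre.
exists (it :: pre), bls; split=> // jt; rewrite inE => /orP[/eqP->//|]; exact: preP.
Qed.

(** [Y] is a union of R-classes, removed one at a time. Cutting before each item in the class [r]
    gives blocks with values in [r], to which [Rclass_bound] applies; the items in between fall to
    the induction hypothesis. As [r] is nonempty, 7 per element pays for the 5 of [Rclass_bound] and
    for two concatenations. *)
Lemma class_bound (Y : {set S}) h l : Y \subset J ->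
  (forall y a, y \in Y -> y * a \in J -> y * a \in Y) ->
  (h + 7 * #|Y| <= K)%N -> bounded h l -> nolow l ->
  (forall it, it \in l -> it.2 \in Y) ->
  Bd (h + 7 * #|Y|) (word l) (value l).
Proof.
have [n] := ubnP #|Y|; elim: n Y l => // n IH Y l ltYn YJ Y_closed le_K B N lY.
case def_l: l => [|it0 l0]; first by rewrite value_nil; apply: Bd_mono Bd_nil.
have YJ' y : y \in Y -> y \in J by exact: (fintype.subsetP YJ).
have y0Y : it0.2 \in Y by apply: lY; rewrite def_l mem_head.
rewrite -def_l {def_l l0}; move: it0.2 y0Y => y0 y0Y {it0}.
(* By stability this is the R-class of [y0]. *)
pose r := [set y in J | [exists c, y == y0 * c]]%SET.
have rP y : reflect (y \in J /\ exists c, y = y0 * c) (y \in r).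
  rewrite inE; apply: (iffP andP) => -[yJ]; first by move/existsP => [c /eqP yE]; split=> //; exists c.
  by case=> c yE; split=> //; apply/existsP; exists c; apply/eqP.
have y0r : y0 \in r by apply/rP; split; [exact: YJ' | exists 1; rewrite mulg1].
have r_in_J y : y \in r -> y \in J by case/rP.
have rY : r \subset Y.
  by apply/fintype.subsetP => y /rP[yJ [c yE]]; rewrite yE in yJ *; exact: Y_closed.
have r_closed x a : x \in r -> x * a \in J -> x * a \in r.
  by move=> /rP[_ [c ->]] xaJ; apply/rP; split=> //; exists (c * a); rewrite mulgA.
have r_class x y : x \in r -> y \in r -> exists c, y = x * c.
  move=> /rP[xJ [c xE]] /rP[_ [d ->]].
  have [|b] := @J_right y0 c (YJ' _ y0Y); first by rewrite -xE.
  by rewrite -xE => ->; exists (b * d); rewrite mulgA.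
pose Y' := (Y :\: r)%SET.
have cardY : (#|Y| = #|r| + #|Y'|)%N.
  by rewrite -(cardsID r Y); congr (_ + _)%N; apply: eq_card => x; rewrite inE andbC;
     case: (boolP (x \in r)) => // /(fintype.subsetP rY) ->.
have r_gt0 : (0 < #|r|)%N by apply/card_gt0P; exists y0.
have restP m : bounded h m -> nolow m -> (forall it, it \in m -> it.2 \in Y) ->
    (forall it, it \in m -> it.2 \notin r) -> Bd (h + 7 * #|Y'|) (word m) (value m).
  move=> Bm Nm mY mr; apply: IH => //.
  - by lia.
  - exact: fintype.subset_trans (finset.subsetDl _ _) YJ.
  - move=> y a; rewrite !finset.in_setD => /andP[yr yY] yaJ; rewrite Y_closed // andbT.
    apply: contra yr => /rP[_ [c yaE]]; apply/rP; split; first exact: YJ'.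
    have [b] := J_right (YJ' _ yY) yaJ.
    by rewrite yaE -mulgA => ->; exists (c * b).
  - by lia.
  - by move=> it it_m; rewrite finset.in_setD mr // mY.
have [pre [bls [def_l preP blsP]]] := block_decomposition r l.
have Bpre : Bd (h + 7 * #|Y'|) (word pre) (value pre).
  apply: restP => //.
  - by move: B; rewrite def_l => /bounded_cat[].
  - by move: N; rewrite def_l => /nolow_prefix.
  - by move=> it it_m; apply: lY; rewrite def_l mem_cat it_m.
pose h1 := (h + 7 * #|Y'|).+1.
have blsB b : b \in bls -> Bd h1 (word b) (value b) /\ value b \in r.
  move=> b_bls; have [it [rest [def_b it_r rest_r]]] := blsP b b_bls.
  have /path.splitPr def_bls := b_bls.
  case: def_bls def_l {blsP b_bls} => bls1 bls2; rewrite flatten_cat /= => def_l.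
  have Bb : bounded h b.
    by move: B; rewrite def_l => /bounded_cat[_ /bounded_cat[_ /bounded_cat[]]].
  have Nb : nolow b by move: N; rewrite def_l catA => /nolow_factor.
  have bY jt : jt \in b -> jt.2 \in Y.
    by move=> jb; apply: lY; rewrite def_l !mem_cat jb !orbT.
  split.
    rewrite def_b word_cons value_cons; apply: Bd_cat.
      by apply: (@Bd_mono h); [lia | apply: Bb; rewrite def_b mem_head].
    apply: restP => //.
    - by move: Bb; rewrite def_b -cat1s => /bounded_cat[].
    - by move: Nb; rewrite def_b -cat1s => /nolow_suffix.
    - by move=> jt j_rest; apply: bY; rewrite def_b inE j_rest orbT.
  have vJ : value b \in J.
    apply: (@nolow_value h) => //; [by lia | | by rewrite def_b].
    by move=> jt /bY /YJ' /J_in_I.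
  by move: vJ; rewrite def_b value_cons; apply: r_closed.
have Bbls : Bd (h1 + 5 * #|r|) (word (flatten bls)) (value (flatten bls)).
  rewrite -word_merge -value_merge.
  have mr it : it \in [seq block_item b | b <- bls] -> it.2 \in r.
    by case/mapP=> b /blsB[_ vr] ->.
  have Nm : nolow [seq block_item b | b <- bls].
    apply: nolow_merge; first by apply/negP => /blsP[? [? []]].
    by move: N; rewrite def_l => /nolow_suffix.
  have Bm : bounded h1 [seq block_item b | b <- bls].
    by move=> _ /mapP[b /blsB[] ? _ ->].
  (* With [q = 1] the prefix products are the values of the prefixes; they start in [r] and stay in
     [J], so [P] can be [r] itself. *)
  apply: (@Rclass_bound r r_in_J r_closed r_class _ r _ _ 1) => //.
  - by apply/fintype.subsetP.
  - by lia.
  - move=> l1 l2 def_m l1_nil; rewrite mul1g.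
    have l1r it : it \in l1 -> it.2 \in r.
      by move=> it_l1; apply: mr; rewrite def_m mem_cat it_l1.
    have l1J : value l1 \in J.
      apply: (@nolow_value h1) => //; first by lia.
      + by move: Nm; rewrite def_m => /nolow_prefix.
      + by move: Bm; rewrite def_m => /bounded_cat[].
      + by move=> it /l1r /r_in_J /J_in_I.
    case: l1 l1_nil {def_m} l1r l1J => // it l1 _ l1r; rewrite value_cons.
    by apply: r_closed; apply: l1r; rewrite mem_head.
rewrite def_l word_cat value_cat.
apply: (@Bd_cat2 (h + 7 * #|Y'|)); [by lia | exact: Bpre |].
by apply: Bd_mono Bbls; lia.
Qed.

(** Reading from left to right, the tail grows as long as it satisfies [nolow], so that
    [class_bound] covers it by its exact value. As soon as some factor has a cover outside [J], the
    tail is closed as a block. *)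
Lemma greedy_decomposition h l : (h < K)%N -> (h + 7 * #|J| <= K)%N -> bounded h l ->
  (forall it, it \in l -> it.2 \in I) ->
  exists bls tl, [/\ l = flatten bls ++ tl,
    forall b, b \in bls -> exists z, [/\ Bd K.+1 (word b) z, z \in I & z \notin J] &
    Bd K (word tl) (value tl)].
Proof.
move=> h_lt_K le_K.
have exact m : bounded h m -> (forall it, it \in m -> it.2 \in I) -> nolow m ->
    Bd K (word m) (value m).
  move=> Bm mI Nm; apply: (Bd_mono le_K); apply: class_bound => //.
  by move=> it it_m; exact: (nolow_item h_lt_K Nm Bm mI it_m).
move=> B lI.
suff [bls [tl [def_l blsP Ntl]]] : exists bls tl, [/\ l = flatten bls ++ tl,
    forall b, b \in bls -> exists z, [/\ Bd K.+1 (word b) z, z \in I & z \notin J] &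
    nolow tl].
  exists bls, tl; split=> //; apply: exact => //.
    by move: B; rewrite def_l => /bounded_cat[].
  by move=> it it_l; apply: lI; rewrite def_l mem_cat it_l orbT.
elim/last_ind: l B lI => [|l it IH] B lI.
  by exists [::], [::]; split=> // -[|//] [|//].
move: B; rewrite -cats1 => /bounded_cat[Bl Bit].
have [|bls [tl [def_l blsP Ntl]]] := IH Bl.
  by move=> jt jl; apply: lI; rewrite mem_rcons inE jl orbT.
have [N|low] := pselect (nolow (tl ++ [:: it])).
  by exists bls, (tl ++ [:: it]); split=> //; rewrite def_l -catA.
(* The tail had no low factor before [it] came, so the low factor ends with [it]. The part [l1]
   before it is covered exactly at height [K], and the block at height [K.+1] by a value outside
   [J]. *)
have [l1 [l2 [z [def_tl l2_nil Bz [zI zJ]]]]] : exists l1 l2 z,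
    [/\ tl ++ [:: it] = l1 ++ l2, l2 != [::], Bd K (word l2) z & z \in I /\ z \notin J].
  apply: contrapT => nex; apply: low => l1 l2 l3 def_tl l2_nil z Bz zI.
  apply: contrapT => zJ.
  case/lastP: l3 def_tl => [|l3 jt]; first rewrite cats0 => def_tl.
    by apply: nex; exists l1, l2, z; split=> //; split=> //; apply/negP.
  rewrite -!cats1 !catA cats1 [RHS]cats1 => /rcons_inj[def_tl _].
  by apply: zJ; apply: (Ntl l1 l2 l3) => //; rewrite def_tl catA.
have Btl : bounded h (tl ++ [:: it]).
  by apply/bounded_cat; split=> //; move: Bl; rewrite def_l => /bounded_cat[].
have tlI jt : jt \in tl ++ [:: it] -> jt.2 \in I.
  by move=> jt_tl; apply: lI; rewrite -cats1 def_l -catA mem_cat jt_tl orbT.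
case/lastP: l2 l2_nil def_tl Bz => // l2 jt _ def_tl Bz.
rewrite -!cats1 catA !cats1 in def_tl; case/rcons_inj: def_tl => def_tl eq_it.
have Nl1 : nolow l1 by apply: (@nolow_prefix _ l2); rewrite -def_tl.
exists (rcons bls (tl ++ [:: it])), [::]; split=> //.
- by rewrite -cats1 flatten_cat /= !cats0 def_l -catA.
- move=> b; rewrite mem_rcons inE => /orP[/eqP->|/blsP//].
  exists (value l1 * z); split.
  + rewrite def_tl eq_it -catA word_cat cats1; apply: Bd_cat => //; apply: exact => //.
      by move: Btl; rewrite def_tl -catA => /bounded_cat[].
    by move=> kt kt_l; apply: tlI; rewrite def_tl !mem_cat kt_l.
  + exact: I_l.
  + by apply: contra zJ; exact: J_up_l.
by move=> [|? ?] [|? ?].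
Qed.

End Class.

(** A maximal J-class [J] is removed from the ideal [I]: the greedy blocks become items for
    [I :\: J]. Besides the 7 per element of [class_bound], closing a block and attaching the tail
    cost 1 each, whence 9. *)
Lemma ideal_bound (I : {set S}) h l :
  (forall a x b, x \in I -> a * x * b \in I) -> bounded h l ->
  (forall it, it \in l -> it.2 \in I) -> exists z, Bd (h + 9 * #|I|) (word l) z.
Proof.
have [n] := ubnP #|I|; elim: n I h l => // n IH I h l ltIn I_ideal B lI.
have [I0|[x1 x1I]] := set_0Vmem I.
  case: l lI {B} => [|it l] lI; first by exists 1; apply: Bd_mono Bd_nil.
  by have := lI it (mem_head _ _); rewrite I0 inE.
pose gen (x : S) := [set y : S | [exists a, exists b, y == a * x * b]]%SET.
have genP x y : reflect (exists a b, y = a * x * b) (y \in gen x).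
  rewrite inE; apply: (iffP existsP) => -[a]; first by case/existsP=> b /eqP; exists a, b.
  by case=> b /eqP yE; exists a; apply/existsP; exists b.
have gen_sub x y : x \in gen y -> gen x \subset gen y.
  case/genP=> a [b ->]; apply/fintype.subsetP => _ /genP[c [d ->]]; apply/genP.
  by exists (c * a), (b * d); rewrite !mulgA.
have gen_refl x : x \in gen x by apply/genP; exists 1, 1; rewrite mul1g mulg1.
(* An element of [I] whose two-sided ideal has the largest size. If [x0] lies in the ideal of [y],
   both ideals coincide, so the J-class of [x0] is maximal in [I]. *)
have [x0 x0I x0max] : exists2 x0, x0 \in I & forall y, y \in I -> (#|gen y| <= #|gen x0|)%N.
  by case: (@arg_maxnP _ x1 (mem I) (fun x => #|gen x|) x1I) => x0; exists x0.
pose J := [set y in I | x0 \in gen y]%SET.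
have genJ y : y \in J -> gen y = gen x0.
  rewrite inE => /andP[yI x0y]; apply/esym/eqP.
  by rewrite eqEcard gen_sub //= x0max.
have J_in_I x : x \in J -> x \in I by rewrite inE => /andP[].
have J_up x a b : x \in I -> a * x * b \in J -> x \in J.
  move=> xI; rewrite [a * x * b \in J]inE [x \in J]inE xI => /andP[_].
  apply: (fun H => fintype.subsetP H x0).
  by apply/gen_sub/genP; exists a, b.

have J_class x y : x \in J -> y \in J -> exists a b, x = a * y * b.
  by move=> xJ yJ; apply/genP; rewrite (genJ y) // -(genJ x).
have x0J : x0 \in J by rewrite inE x0I gen_refl.
have J_gt0 : (0 < #|J|)%N by apply/card_gt0P; exists x0.
pose I' := (I :\: J)%SET.
have cardI : (#|I| = #|J| + #|I'|)%N.
  rewrite -(cardsID J I); congr (_ + _)%N; apply: eq_card => x; rewrite inE.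
  by case: (boolP (x \in J)) => [/J_in_I ->|]; rewrite ?andbF.
pose K := (h + 7 * #|J|)%N.
have [||bls [tl [def_l blsP Btl]]] :=
  @greedy_decomposition I J I_ideal J_in_I J_up J_class K h l _ _ B lI; rewrite /K; try by lia.
have [l' [word_l' Bl' l'I]] : exists l', [/\ word l' = word (flatten bls), bounded K.+1 l' &
    forall it, it \in l' -> it.2 \in I'].
  elim: bls blsP {def_l} => [|b bls IHb] blsP; first by exists [::].
  have [|l' [wE Bl' l'I]] := IHb; first by move=> c cb; apply: blsP; rewrite inE cb orbT.
  have [z [Bz zI zJ]] := blsP b (mem_head _ _).
  exists ((word b, z) :: l'); split.
  - by rewrite word_cons word_cat wE.
  - by move=> it; rewrite inE => /orP[/eqP->|/Bl'].
  - by move=> it; rewrite inE => /orP[/eqP->|/l'I//]; rewrite finset.in_setD zJ.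
have [||z Bz] := IH I' K.+1 l' _ _ Bl' l'I; first by lia.
  move=> a x b; rewrite !finset.in_setD => /andP[xJ xI]; rewrite I_ideal // andbT.
  by apply: contra xJ; exact: J_up.
exists (z * value tl); rewrite def_l word_cat -word_l'.
apply: (Bd_cat2 _ Bz); first by rewrite /K; lia.
by apply: Bd_mono Btl; rewrite /K; lia.
Qed.

Theorem factorization_bound w : (forall a, exists x, Bd 0 [:: a] x) ->
  exists x, Bd (9 * #|S|) w x.
Proof.
move=> Bletter.
have [l [<- Bl]] : exists l, word l = w /\ bounded 0 l.
  elim: w => [|a w [l [<- Bl]]]; first by exists [::].
  have [x Bx] := Bletter a; exists (([:: a], x) :: l); split=> // it.
  by rewrite inE => /orP[/eqP->|/Bl].
have [||z] := @ideal_bound [set: S]%SET 0 l _ Bl; [by move=> *; rewrite inE.. |].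
by rewrite cardsT add0n; exists z.
Qed.
End Forest.

(** * Words *)

Section Words.
Variable A : finType.
Implicit Types u v w x y : seq A.
Local Notation plain := (@pred0 A).

Lemma lesssim2_refl k : reflexive (@lesssim2 A k).
Proof. by move=> u; apply/asboolP. Qed.

Lemma lesssim2_trans k : transitive (@lesssim2 A k).
Proof.
by move=> v u w /asboolP uv /asboolP vw; apply/asboolP => f fS fk /(uv _ fS fk); exact: vw.
Qed.

Lemma lesssim2_mono k k' u v : k <= k' -> lesssim2 k' u v -> lesssim2 k u v.
Proof.
move=> kk' /asboolP uv; apply/asboolP => f fS fk; apply: uv => //.
exact: leq_trans kk'.
Qed.

Lemma lesssim2_cat k u u' v v' :
  lesssim2 k u u' -> lesssim2 k v v' -> lesssim2 k (u ++ v) (u' ++ v').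
Proof. by move=> /lesssim2P uu' /lesssim2P vv'; apply/lesssim2P/game2_cat. Qed.

Lemma lesssim2_forth k u v : lesssim2 k.+1 u v -> forth (fun x y => lesssim2 k x y) u v.
Proof.
by move=> /lesssim2P[_ [F _]]; apply: forth_mono F => x y; exact: (lesssim2P k x y).2.
Qed.

Lemma lesssim2_back k u v : lesssim2 k.+1 u v -> forth (game1 plain k) v u.
Proof. by move=> /lesssim2P[_ [_ B]]. Qed.

Lemma mem_split a w : a \in w -> exists w1 w2, w = w1 ++ a :: w2.
Proof. by case/path.splitPr=> w1 w2; exists w1, w2. Qed.

Lemma forth_mem (R : seq A -> seq A -> Prop) u v : forth R u v -> {subset u <= v}.
Proof.
move=> F a /mem_split[u1 [u2 def_u]]; have [v1 [v2 [-> _ _]]] := F _ _ _ def_u.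
by rewrite mem_cat mem_head orbT.
Qed.

Lemma lesssim2_alph k u v : 0 < k -> lesssim2 k u v -> alph u = alph v.
Proof.
case: k => // k _ uv; have F := lesssim2_forth uv; have B := lesssim2_back uv.
by apply/setP => a; rewrite !inE; apply/idP/idP; [exact: forth_mem F a | exact: forth_mem B a].
Qed.

Lemma lesssim2_nil k v : 0 < k -> lesssim2 k [::] v -> v = [::].
Proof.
case: k v => // k [//|a v] _ /lesssim2_back B.
by have [[|? ?] [? []]] := B [::] a v erefl.
Qed.

(** One round finds [a] in [v], and a second one forces both sides of it to be empty. *)
Lemma lesssim2_letter k a v : 1 < k -> lesssim2 k [:: a] v -> v = [:: a].
Proof.
case: k => [|[|k]] // _ /lesssim2_forth F.
have [v1 [v2 [-> G1 G2]]] := F [::] a [::] erefl.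
by rewrite (lesssim2_nil _ G1) // (lesssim2_nil _ G2).
Qed.

(** A pebble on the last letter of [u] makes the cut, at the cost of one round. *)
Lemma lesssim2_split k u v w : lesssim2 k.+1 (u ++ v) w ->
  exists w1 w2, [/\ w = w1 ++ w2, lesssim2 k u w1 & lesssim2 k v w2].
Proof.
case/lastP: u => [|u a].
  move=> /(lesssim2_mono (leqnSn k)) vw; exists [::], w; split=> //.
  exact: lesssim2_refl.
rewrite cat_rcons => /lesssim2_forth F.
have [w1 [w2 [-> G1 G2]]] := F _ _ _ erefl.
exists (rcons w1 a), w2; rewrite cat_rcons; split=> //.
by rewrite -!cats1; apply: lesssim2_cat => //; exact: lesssim2_refl.
Qed.

Definition power n w := flatten (nseq n w).

Lemma powerD m n w : power (m + n) w = power m w ++ power n w.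
Proof. by rewrite /power nseqD flatten_cat. Qed.

Lemma powerS n w : power n.+1 w = w ++ power n w.
Proof. by []. Qed.

Lemma power_mid n w x a y : power n w = x ++ a :: y ->
  exists i j w1 w2, [/\ n = (i + j).+1, w = w1 ++ a :: w2,
    x = power i w ++ w1 & y = w2 ++ power j w].
Proof.
elim: n x => [|n IH] x; first by case: x.
rewrite powerS => def_p; have [[w2 def_w ->]|[z -> def_z]] := cat_eq_mid def_p.
  by exists 0, n, x, w2.
have [i [j [w1 [w2 [-> def_w -> ->]]]]] := IH _ def_z.
by exists i.+1, j, w1, w2; rewrite powerS catA.
Qed.

Lemma game1_nil k v : game1 plain k [::] v.
Proof.
by case: k => [|k]; split; rewrite ?filter_plain // => -[].
Qed.

(** Any letter of [x] can be answered in any copy of [w]. The answer leaves at least [2 ^ k - 1]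
    copies on either side, which with its own copy makes [2 ^ k.+1 - 1]. *)
Lemma game1_power k p w x : 2 ^ k <= p.+1 -> {subset x <= w} -> game1 plain k x (power p w).
Proof.
elim: k p x => [|k IH] p x; first by split; rewrite ?filter_plain.
rewrite expnS => le_p xw; split; first by rewrite !filter_plain.
move=> x1 a x2 def_x; have /mem_split[w1 [w2 def_w]] : a \in w.
  by apply: xw; rewrite def_x mem_cat mem_head orbT.
have le_k : 0 < 2 ^ k by rewrite expn_gt0.
pose i := (2 ^ k).-1; pose j := p - i.+1.
exists (power i w ++ w1), (w2 ++ power j w); split.
- rewrite -[p in LHS](_ : i + j.+1 = p); last by rewrite /i /j; lia.
  by rewrite powerD powerS {2}def_w -!catA.
- rewrite -[x1]cats0; apply: game1_cat; last exact: game1_nil.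
  apply: IH => [|b bx]; first by rewrite /i; lia.
  by apply: xw; rewrite def_x mem_cat bx.
- rewrite -[x2]cat0s; apply: game1_cat; first exact: game1_nil.
  apply: IH => [|b bx]; first by rewrite /j /i; lia.
  by apply: xw; rewrite def_x mem_cat inE bx !orbT.
Qed.

Lemma mem_power n w : {subset power n w <= w}.
Proof. by elim: n => //= n IH a; rewrite powerS mem_cat => /orP[//|/IH]. Qed.

(** A switch of words is answered by [game1_power]. Otherwise, if few copies of [w] lie on one side
    of the pebble, the answer reproduces that side exactly and leaves [x] in the long side, where
    the induction hypothesis applies. *)
Lemma game2_pump k p q1 q2 w x : 4 ^ k <= p -> 4 ^ k <= q1 -> 4 ^ k <= q2 ->
  {subset x <= w} -> game2 plain k (power p w) (power q1 w ++ x ++ power q2 w).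
Proof.
elim: k p q1 q2 x => [|k IH] p q1 q2 x; first by split; rewrite ?filter_plain.
have k_gt0 : 0 < 4 ^ k by rewrite expn_gt0.
move=> le_p le_q1 le_q2 xw; split; first by rewrite !filter_plain.
split; last first.
  have [_ F] : game1 plain k.+1 (power q1 w ++ x ++ power q2 w) (power p w) by
    apply: game1_power => [|a];
    [ by apply: leq_trans (leqnSn _); apply: leq_trans le_p; rewrite leq_exp2r
    | by rewrite !mem_cat => /or3P[/mem_power|/xw|/mem_power]].
  exact: F.
rewrite expnS in le_p le_q1 le_q2.
move=> _ a _ /power_mid[i [j [w1 [w2 [def_p def_w -> ->]]]]].
have answer i' j' u' v' :
    power q1 w ++ x ++ power q2 w = power i' w ++ u' ++ w ++ v' ++ power j' w ->
    game2 plain k (power i w) (power i' w ++ u') ->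
    game2 plain k (power j w) (v' ++ power j' w) ->
    exists v1 v2, [/\ power q1 w ++ x ++ power q2 w = v1 ++ a :: v2,
      game2 plain k (power i w ++ w1) v1 & game2 plain k (w2 ++ power j w) v2].
  move=> -> G1 G2; exists ((power i' w ++ u') ++ w1), (w2 ++ v' ++ power j' w).
  split; [by rewrite {2}def_w -!catA | |]; apply: game2_cat => //; exact: game2_refl.
have splitq m q : m < q -> power q w = power m w ++ w ++ power (q - m.+1) w.
  by move=> lt_mq; rewrite -powerS -powerD; congr power; lia.
have splitq' m q : m < q -> power q w = power (q - m.+1) w ++ w ++ power m w.
  by move=> lt_mq; rewrite -powerS -powerD; congr power; lia.
have [small_i|big_i] := ltnP i (4 ^ k).
  apply: (answer i q2 [::] (power (q1 - i.+1) w ++ x)); rewrite ?cats0 -?catA.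
  - by rewrite (splitq i q1) -?catA //; lia.
  - exact: game2_refl.
  - by apply: IH => //; lia.
have [small_j|big_j] := ltnP j (4 ^ k).
  apply: (answer q1 j (x ++ power (q2 - j.+1) w) [::]); rewrite ?cat0s -?catA.
  - by rewrite (splitq' j q2) -?catA //; lia.
  - by apply: IH => //; lia.
  - exact: game2_refl.
(* Both sides are long: the answer goes into the second block, after [4 ^ k] copies. To its right
   two powers of [w] are compared by the induction hypothesis with the empty word inserted. *)
pose j' := q2 - (4 ^ k).+1.
apply: (answer q1 j' (x ++ power (4 ^ k) w) [::]); rewrite ?cat0s -?catA.
- by rewrite (splitq (4 ^ k) q2) -?catA //; lia.
- by apply: IH => //; lia.
- rewrite -[power j' w](_ : power (4 ^ k) w ++ [::] ++ power (j' - 4 ^ k) w = _).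
    by apply: IH => //; rewrite /j'; lia.
  by rewrite cat0s -powerD subnKC //; rewrite /j'; lia.
Qed.

Lemma lesssim2_pump k w x : {subset x <= w} ->
  lesssim2 k (power (4 ^ k) w ++ power (4 ^ k) w) (power (4 ^ k) w ++ x ++ power (4 ^ k) w).
Proof.
by move=> xw; rewrite -powerD; apply/lesssim2P/game2_pump => //; rewrite leq_addr.
Qed.

Lemma path_lesssim2_cat k u v us vs : size us = size vs ->
  path (lesssim2 k) u us -> path (lesssim2 k) v vs ->
  path (lesssim2 k) (u ++ v) [seq p.1 ++ p.2 | p <- zip us vs].
Proof.
elim: us u v vs => [|u' us IH] u v [|v' vs] //= [sz] /andP[uu' us_path] /andP[vv' vs_path].
by rewrite lesssim2_cat ?IH.
Qed.

Lemma path_lesssim2_split k u v ws : path (lesssim2 k.+1) (u ++ v) ws ->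
  exists us vs, [/\ size us = size vs, ws = [seq p.1 ++ p.2 | p <- zip us vs],
    path (lesssim2 k) u us & path (lesssim2 k) v vs].
Proof.
elim: ws u v => [|w ws IH] u v /=; first by exists [::], [::].
case/andP=> /lesssim2_split[u' [v' [-> uu' vv']]] /IH[us [vs [sz -> us_path vs_path]]].
by exists (u' :: us), (v' :: vs); rewrite /= sz uu' vv'.
Qed.

Lemma path_lesssim2_mono k k' u us : k <= k' ->
  path (lesssim2 k') u us -> path (lesssim2 k) u us.
Proof. by move=> kk'; apply: sub_path => v w; exact: lesssim2_mono. Qed.

Lemma path_lesssim2_const k u us : (forall v, lesssim2 k u v -> v = u) ->
  path (lesssim2 k) u us -> us = nseq (size us) u.
Proof.
move=> uP; elim: us => //= v us IH /andP[/uP-> us_path].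
by rewrite {1}IH.
Qed.

Lemma path_lesssim2_nseq k u n : path (lesssim2 k) u (nseq n u).
Proof. by elim: n => //= n ->; rewrite lesssim2_refl. Qed.

Lemma path_lesssim2_head k u v us : lesssim2 k u v -> path (lesssim2 k) v us ->
  path (lesssim2 k) u us.
Proof.
by move=> uv; case: us => //= w us /andP[vw ->]; rewrite (lesssim2_trans uv vw).
Qed.
End Words.
(** Joins the product monoid with finiteness, so that junctures form a [finMonoidType] to which the
    factorization theorem applies. *)
HB.instance Definition _ (M N : finMonoidType) := Monoid.on (M * N)%type.

Section Tuples.
Variables (M : finMonoidType) (m : nat).

Lemma val_tuple_mul (s t : m.-tuple M) :
  val (tuple_mul s t) = [seq (p.1 * p.2)%g | p <- zip s t].
Proof.
apply: (@eq_from_nth _ 1%g) => [|i]; first by rewrite size_tuple size_map size_zip !size_tuple minnn.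
rewrite size_tuple => lt_im; pose o := Ordinal lt_im.
rewrite -(tnth_nth _ _ o) tnth_mktuple !(tnth_nth 1%g).
rewrite (nth_map (1%g, 1%g)); last by rewrite size_zip !size_tuple minnn.
by rewrite nth_zip // !size_tuple.
Qed.

Lemma tuple_set_mulS (S S' T T' : tuple_set M m) :
  (S \subset S')%SET -> (T \subset T')%SET -> (tuple_set_mul S T \subset tuple_set_mul S' T')%SET.
Proof.
move=> SS' TT'; apply/fintype.subsetP => x /tuple_set_mulP[s [t [sS tT ->]]].
by apply/tuple_set_mulP; exists s, t; rewrite (fintype.subsetP SS') ?(fintype.subsetP TT').
Qed.

Lemma mem_tuple_set_mul (S T : tuple_set M m) s t :
  s \in S -> t \in T -> tuple_mul s t \in tuple_set_mul S T.
Proof. by move=> sS tT; apply/tuple_set_mulP; exists s, t. Qed.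

Lemma val_tuple_const (a : M) : val [tuple a | i < m] = nseq m a.
Proof.
have -> // : [tuple a | i < m] = [tuple of nseq m a].
by apply: eq_from_tnth => i; rewrite tnth_mktuple (tnth_nth a) nth_nseq ltn_ord.
Qed.
End Tuples.

(** * Junctures *)

Section Junctures.
Variables (A : finType) (M : finMonoidType) (alpha : UMagmaMorphism.type (seq A) M).
Implicit Types (u v w : seq A).

Lemma morph_cat u v : alpha (u ++ v) = (alpha u * alpha v)%g.
Proof. exact: gmulfM. Qed.
Lemma morph_nil : alpha [::] = 1%g.
Proof. exact: gmulf1. Qed.
Lemma morph_power q w : alpha (power q w) = (alpha w ^+ q)%g.
Proof. by elim: q => [|q IH]; rewrite ?morph_nil // powerS morph_cat IH expgS. Qed.

Lemma alph_power q w : 0 < q -> alph (power q w) = alph w.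
Proof.
move=> q_gt0; apply/setP => a; rewrite !inE; apply/idP/idP; first exact: mem_power.
by case: q q_gt0 => // q _ aw; rewrite powerS mem_cat aw.
Qed.

Lemma map_morph_cat us vs : size us = size vs ->
  map alpha [seq p.1 ++ p.2 | p <- zip us vs] =
  [seq (p.1 * p.2)%g | p <- zip (map alpha us) (map alpha vs)].
Proof.
by elim: us vs => [|u us IH] [|v vs] //= [/IH->]; rewrite morph_cat.
Qed.

Lemma fst_expg n (x : juncture M n) q : ((x ^+ q)%g).1 = (x.1 ^+ q)%g.
Proof. by elim: q => // q IH; rewrite !expgS -IH. Qed.

Lemma expg_idem (S : monoidType) (x : S) q : 0 < q -> (x * x)%g = x -> (x ^+ q)%g = x.
Proof. by case: q => // q _ xx; elim: q => // q IH; rewrite expgS IH. Qed.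

Section Dim.
Variable n : nat.
Implicit Types (x y e : juncture M n) (t : n.-1.-tuple M).

(** The word is kept explicit, since the closure rules build the new word from it by products and
    powers. *)
Definition witness k w x := alpha w = x.1 /\
  forall t, t \in x.2 -> exists2 ws, path (lesssim2 k) w ws & map alpha ws = t.

Lemma junctures_rankE k x : 1 < n -> junctures_rank alpha k n x <-> exists w, witness k w x.
Proof.
move=> n_gt1; split=> [[_ [w wx xP]]|[w [wx xP]]]; first by exists w.
by split; [move=> n1; rewrite n1 in n_gt1 | exists w].
Qed.

Lemma witness_mul k u v x y : witness k u x -> witness k v y -> witness k (u ++ v) (x * y)%g.
Proof.
move=> [ux xP] [vy yP]; split; first by rewrite morph_cat ux vy.
move=> t /tuple_set_mulP[s [s' [/xP[us us_path us_s] /yP[vs vs_path vs_s'] ->]]].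
have sz : size us = size vs.
  by rewrite -(size_map alpha us) -(size_map alpha vs) us_s vs_s' !size_tuple.
exists [seq p.1 ++ p.2 | p <- zip us vs]; first exact: path_lesssim2_cat.
by rewrite map_morph_cat // us_s vs_s' val_tuple_mul.
Qed.

Lemma witness_power k w e q : (e * e)%g = e -> witness k w e -> witness k (power q.+1 w) e.
Proof.
move=> ee we; elim: q => [|q IH]; first by rewrite /power /= cats0.
by rewrite powerS -ee; exact: witness_mul.
Qed.

(* Unlike [sat_closed] this does not mention [omega], which is not given for the
   smaller dimensions of the induction. *)
Definition idem_closed (X : set (juncture M n)) : Prop :=
  [/\ (down_closure n X `<=` X)%classic,
      forall x y, X x -> X y -> X (x * y)%g &
      forall e, X e -> (e * e = e)%g -> X (e * (1, compatible_chains alpha n e.1) * e)%g].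

Hypothesis alphaP : alphabet_compatible alpha.
Hypothesis n_gt1 : 1 < n.

Lemma compatible_chainsP s t : reflect (chains alpha n.-1 t /\ alph_of alpha (head 1%g t) = alph_of alpha s)
  (t \in compatible_chains alpha n s).
Proof.
rewrite inE; apply: (iffP andP) => -[tC ts]; split; [by rewrite inE in tC|exact/eqP| by rewrite inE |exact/eqP].
Qed.

Lemma junctures_idem_closed : idem_closed (junctures alpha n).
Proof.
split.
- move=> x [S xS SP] k _; apply/junctures_rankE => //.
  have /junctures_rankE[//|w [wx wS]] := xS k I.
  by exists w; split=> // t /(fintype.subsetP SP) /wS.
- move=> x y xJ yJ k _; apply/junctures_rankE => //.
  have /junctures_rankE[//|u ux] := xJ k I; have /junctures_rankE[//|v vy] := yJ k I.
  by exists (u ++ v); exact: witness_mul.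
move=> e eJ ee k _; apply/junctures_rankE => //.
have /junctures_rankE[//|w we] := eJ k I.
have [q def_q] : exists q, 4 ^ k = q.+1 by exists (4 ^ k).-1; rewrite prednK // expn_gt0.
pose p := power (4 ^ k) w.
have [pe eP] : witness k p e by rewrite /p def_q; exact: witness_power.
(* One word serves all tuples: [p ++ p] lies below [p ++ m ++ p] for every [m] over the alphabet of
   [w], in particular for the first word [m] of any compatible chain. *)
exists (p ++ p); split; first by rewrite morph_cat pe /= mulg1.
move=> t /tuple_set_mulP[_ [s2 [/tuple_set_mulP[s1 [r [s1e rT ->]]] s2e ->]]].
have [us us_path us_s] := eP _ s1e; have [vs vs_path vs_s] := eP _ s2e.
have [rC r_alph] := compatible_chainsP _ _ rT.
have [ms ms_sorted ms_r] := rC k.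
have sz_us : size us = n.-1 by rewrite -(size_map alpha us) us_s size_tuple.
have sz_vs : size vs = n.-1 by rewrite -(size_map alpha vs) vs_s size_tuple.
have sz_ms : size ms = n.-1 by rewrite -(size_map alpha ms) ms_r size_tuple.
case: ms => [|m ms] in ms_sorted ms_r sz_ms *; first by move: n_gt1 sz_ms => /=; lia.
have mw : {subset m <= w}.
  have : alph m = alph w.
    rewrite -(alph_of_image _ _ _ m alphaP) -(alph_of_image _ _ _ w alphaP).
    by case: we => -> _; rewrite -r_alph -ms_r.
  by move=> /setP eq_alph a am; have := eq_alph a; rewrite !inE am.
have sz_um : size us = size (m :: ms) by rewrite sz_us sz_ms.
exists [seq a.1 ++ a.2 | a <- zip [seq a.1 ++ a.2 | a <- zip us (m :: ms)] vs].
  apply: (@path_lesssim2_head _ _ _ ((p ++ m) ++ p)).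
    by rewrite -catA; exact: lesssim2_pump.
  apply: path_lesssim2_cat => //.
    by rewrite size_map size_zip -sz_um minnn sz_us.
  by apply: path_lesssim2_cat => //=; rewrite lesssim2_refl.
rewrite map_morph_cat; last by rewrite size_map size_zip -sz_um minnn sz_us.
by rewrite map_morph_cat // us_s vs_s ms_r !val_tuple_mul.
Qed.

Lemma diagonal_junctures_sub : (diagonal_junctures alpha n `<=` junctures alpha n)%classic.
Proof.
move=> _ [w ->] k _; apply/junctures_rankE => //; exists w; split=> // t /set1P->.
exists (nseq n.-1 w); first exact: path_lesssim2_nseq.
by rewrite val_tuple_const map_nseq.
Qed.

(** Dropping the first word of a path leaves a chain, at every rank; and a single round makes the
    next word share the alphabet of the first. *)
Lemma junctures_chain x t : junctures alpha n x -> t \in x.2 ->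
  chains alpha n.-1 t /\ alph_of alpha (head 1%g t) = alph_of alpha x.1.
Proof.
move=> xJ tx.
have wP k : exists w ws, [/\ alpha w = x.1, path (lesssim2 k) w ws & map alpha ws = t].
  have /junctures_rankE[//|w [wx /(_ t tx)[ws ws_path ws_t]]] := xJ k I.
  by exists w, ws.
split=> [k|].
  by have [w [ws [_ /path_sorted ws_sorted ws_t]]] := wP k; exists ws.
have [w [[|w1 ws] [wx ws_path ws_t]]] := wP 1.
  by have := size_tuple t; rewrite -ws_t /=; lia.
rewrite -ws_t -wx /= !alph_of_image //; apply/esym/(@lesssim2_alph _ 1) => //.
by case/andP: ws_path.
Qed.

(** * Completeness: every word has a cover in [X] *)

Section Completeness.
(** [X] is taken twice: as the junctures, which shows that the rank [ell] suffices, and as the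
    saturation. *)
Variables (X : set (juncture M n)) (k0 : nat).
Hypothesis X_closed : idem_closed X.
Hypothesis X_diagonal : (diagonal_junctures alpha n `<=` X)%classic.
Hypothesis X_junctures : (X `<=` junctures alpha n)%classic.
Hypothesis k0_gt1 : 1 < k0.
Hypothesis k0_chains : forall t ws, sorted (lesssim2 k0) ws -> map alpha ws = t ->
  chains alpha n.-1 t.

Definition covers h w x := [/\ X x, alpha w = x.1 &
  forall t ws, path (lesssim2 (k0 + h)) w ws -> map alpha ws = t -> t \in x.2].

Lemma covers_mono h h' w x : h <= h' -> covers h w x -> covers h' w x.
Proof.
move=> hh' [Xx wx xP]; split=> // t ws ws_path; apply: xP.
by apply: path_lesssim2_mono ws_path; rewrite leq_add2l.
Qed.

(** Provides the leaves of the forest: the empty word and the single letters are rigid. *)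
Lemma covers_rigid w : (forall v, lesssim2 k0 w v -> v = w) ->
  covers 0 w (alpha w, [set [tuple alpha w | i < n.-1]]%SET).
Proof.
move=> wP; split=> //; first by apply: X_diagonal; exists w.
move=> t ws; rewrite addn0 => /(path_lesssim2_const wP) def_ws ws_t; apply/set1P.
have sz : size ws = n.-1 by rewrite -(size_map alpha ws) ws_t size_tuple.
by apply/val_inj; rewrite val_tuple_const /= -ws_t def_ws sz map_nseq.
Qed.

Lemma covers_nil : covers 0 [::] 1%g.
Proof.
have := @covers_rigid [::] (fun v => lesssim2_nil (ltnW k0_gt1)).
by rewrite morph_nil.
Qed.

Lemma covers_cat h u v x y : covers h u x -> covers h v y -> covers h.+1 (u ++ v) (x * y)%g.
Proof.
move=> [Xx ux xP] [Xy vy yP]; split; first by case: X_closed => _ mulX _; exact: mulX.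
  by rewrite morph_cat ux vy.
move=> t ws; rewrite addnS => /path_lesssim2_split[us [vs [sz -> us_path vs_path]]] ws_t.
have sz_us : size us == n.-1.
  by rewrite -(size_tuple t) -ws_t !size_map size_zip sz minnn.
have sz_vs : size vs == n.-1 by rewrite -sz.
have szm us' : size us' == n.-1 -> size (map alpha us') == n.-1 by rewrite size_map.
have -> : t = tuple_mul (Tuple (szm _ sz_us)) (Tuple (szm _ sz_vs)).
  by apply/val_inj; rewrite val_tuple_mul /= -ws_t map_morph_cat.
by apply: mem_tuple_set_mul; [exact: xP us_path _ | exact: yP vs_path _].
Qed.

Lemma morph_flatten_idem e us : (e * e)%g = e -> us != [::] -> {in us, forall u, alpha u = e.1} ->
  alpha (flatten us) = e.1.
Proof.
move=> ee; have ee1 : (e.1 * e.1)%g = e.1 by rewrite -[in RHS]ee.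
elim: us => // u [|v us] IH _ usP; first by rewrite /= cats0 usP ?mem_head.
rewrite [flatten _]/(u ++ flatten (v :: us)) morph_cat IH //; last first.
  by move=> z z_us; apply: usP; rewrite inE z_us orbT.
by rewrite usP ?mem_head.
Qed.

(** With at most two factors [f] is [e]. Otherwise two cuts, one round each, split a chain into
    three: the outer parts belong to [e], the middle one to [T]. The product [s = e * (1, T) * e]
    contains the result, and [f] is a power of [s] because an idempotent is wanted. *)
Lemma covers_idem h e us : (e * e)%g = e -> us != [::] -> {in us, forall u, covers h u e} ->
  exists f, [/\ covers h.+2 (flatten us) f, (e * f)%g = f, (f * e)%g = f & (f * f)%g = f].
Proof.
move=> ee us_nil usP; have [X_down X_mul X_idem] := X_closed.
have Xe : X e by case: us us_nil usP => // u us _ /(_ u (mem_head _ _)) [].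
have us_alpha u : u \in us -> alpha u = e.1 by case/usP.
case: us us_nil usP us_alpha => // u us _ usP us_alpha.
have u_cov : covers h u e by apply: usP; exact: mem_head.
case/lastP: us usP us_alpha => [|us v] usP us_alpha.
  by exists e; rewrite /= cats0; split=> //; apply: covers_mono u_cov; rewrite !leqW.
have v_cov : covers h v e by apply: usP; rewrite inE mem_rcons mem_head orbT.
have [us0|us_nil] := eqVneq us [::].
  exists e; rewrite us0 /= cats0; split=> //; apply: (@covers_mono h.+1) => //.
  by rewrite -ee; exact: covers_cat.
pose T := compatible_chains alpha n e.1.
pose s := (e * (1, T) * e)%g.
have Xs : X s by exact: X_idem.
have es : (e * s)%g = s by rewrite /s !mulgA ee.
have se : (s * e)%g = s by rewrite /s -!mulgA ee.
have [m ff] := idempotent_power s; set f := (s ^+ m.+1)%g in ff.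
have Xpow q : X (s ^+ q.+1)%g by elim: q => // q IH; rewrite expgS; exact: X_mul.
have ee1 : (e.1 * e.1)%g = e.1 by rewrite -[in RHS]ee.
have s1 : s.1 = e.1 by rewrite /= mulg1.
have f1 : f.1 = e.1 by rewrite fst_expg s1 expg_idem.
(* The tuples of [e] are themselves compatible chains; hence [e.2], being its own threefold product,
   lies in [s.2]. *)
have e_sub_T : (e.2 \subset T)%SET.
  by apply/fintype.subsetP => t te; apply/compatible_chainsP/junctures_chain => //; exact: X_junctures.
have e_sub_s : (e.2 \subset s.2)%SET.
  rewrite -{1}ee -{1}ee; apply: tuple_set_mulS => //; exact: tuple_set_mulS.
(* As [e * s = s], a power of [s] has [e] as a left factor, and replacing this [e] by the larger [s]
   enlarges the set. *)
have s_sub_f : (s.2 \subset f.2)%SET.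
  rewrite /f; elim: (m) => // q IH; apply: (fintype.subset_trans IH).
  have -> : (s ^+ q.+2)%g.2 = tuple_set_mul s.2 (s ^+ q.+1)%g.2 by [].
  suff {1}-> : (s ^+ q.+1)%g.2 = tuple_set_mul e.2 (s ^+ q.+1)%g.2 by apply: tuple_set_mulS.
  by rewrite -[RHS]/(e * s ^+ q.+1)%g.2 expgS mulgA es.
exists f; split; last exact: ff; last first.
- by rewrite /f expgSr -mulgA se.
- by rewrite /f expgS mulgA es.
split; first exact: Xpow.
  by rewrite f1; apply: morph_flatten_idem.
have -> : flatten (u :: rcons us v) = u ++ (flatten us ++ v).
  by rewrite /= -cats1 flatten_cat /= cats0.
have mid_alpha : alpha (flatten us) = e.1.
  by apply: morph_flatten_idem => // z z_us; apply: us_alpha; rewrite inE mem_rcons inE z_us !orbT.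
move=> t ws; rewrite !addnS => /path_lesssim2_split[us1 [vs1 [sz -> us1_path]]].
move=> /path_lesssim2_split[ms [vs [sz' def_vs1 ms_path vs_path]]] ws_t.
have sz_us1 : size us1 = n.-1.
  by rewrite -(size_tuple t) -ws_t !size_map size_zip sz minnn.
have sz_ms : size ms = n.-1.
  by rewrite -sz_us1 sz def_vs1 size_map size_zip sz' minnn.
have sz_vs : size vs = n.-1 by rewrite -sz'.
have ms_head : head 1%g (map alpha ms) = alpha (head [::] ms).
  by move: sz_ms n_gt1; case: (ms) => //=; lia.
have szm us' : size us' = n.-1 -> size (map alpha us') == n.-1 by rewrite size_map => ->.
have tE : t = tuple_mul (tuple_mul (Tuple (szm _ sz_us1)) (Tuple (szm _ sz_ms))) (Tuple (szm _ sz_vs)).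
  rewrite -tuple_mulA; apply/val_inj; rewrite !val_tuple_mul /= -ws_t def_vs1 map_morph_cat //.
    by rewrite map_morph_cat.
  by rewrite sz def_vs1.
rewrite tE; apply: (fintype.subsetP s_sub_f); apply: mem_tuple_set_mul; first apply: mem_tuple_set_mul.
- case: u_cov => _ _; apply; last by [].
  by apply: path_lesssim2_mono us1_path; rewrite leqnSn.
(* The chain in the middle has rank at least [k0], which makes it genuine by [k0_chains] and fixes
   its alphabet. *)
- have [ms_sorted m1] : sorted (lesssim2 k0) ms /\ alph (head [::] ms) = alph (flatten us).
    have path0 : path (lesssim2 k0) (flatten us) ms.
      by apply: path_lesssim2_mono ms_path; rewrite leq_addr.
    split; first exact: path_sorted path0.
    move: path0 (sz_ms) n_gt1; case: (ms) => [|m1 ms'] /=; first by lia.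
    by case/andP=> /(lesssim2_alph (ltnW k0_gt1)).
  apply/compatible_chainsP; split; first exact: k0_chains ms_sorted _.
  rewrite -mid_alpha alph_of_image // -m1 -(alph_of_image _ _ _ _ alphaP).
  by rewrite [head _ _]ms_head.
case: v_cov => _ _; apply; last by [].
exact: vs_path.
Qed.

(** The word behind [x] has a cover [y] at the height in question. All tuples of [x] come from
    chains of that rank, so [x] lies in the down closure of [y]. *)
Theorem junctures_rank_covered :
  (junctures_rank alpha (k0 + 9 * #|{: juncture M n}|) n `<=` X)%classic.
Proof.
move=> x /junctures_rankE[//|w [wx xP]].
have letters a : exists y, covers 0 [:: a] y.
  by eexists; apply: covers_rigid => v; exact: lesssim2_letter.
have [y [Xy wy yP]] := @factorization_bound A (juncture M n) covers covers_mono covers_nil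
  covers_cat covers_idem w letters.
case: X_closed => X_down _ _; apply: X_down; exists y.2.
  by rewrite -wx wy -surjective_pairing.
by apply/fintype.subsetP => t /xP[ws]; exact: yP.
Qed.
End Completeness.
End Dim.
End Junctures.

(** * The bound [ell], the induction on the length, and saturation *)

Section Main.
Variables (A : finType) (M : finMonoidType) (alpha : UMagmaMorphism.type (seq A) M).
Hypothesis alphaP : alphabet_compatible alpha.

Lemma card_finMonoid_gt0 : 0 < #|M|.
Proof. by apply/card_gt0P; exists 1%g. Qed.

Lemma ell_gt1 n : 0 < n -> 1 < ell M n.
Proof.
rewrite /ell => n_gt0; have M_gt0 := card_finMonoid_gt0.
have : 0 < n * #|M| ^ 2 * 2 ^ (#|M| ^ n.-1) by rewrite !muln_gt0 n_gt0 !expn_gt0 M_gt0.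
by rewrite -!mulnA; lia.
Qed.

(** There are [#|M| * 2 ^ (#|M| ^ m.+1)] junctures. The extra summand
    [9 * #|M| ^ 2 * 2 ^ (#|M| ^ m.+1)] of [ell M m.+2] pays for nine times as many, and the
    exponential in the other summands only grows. *)
Lemma ell_step m : ell M m.+1 + 9 * #|{: juncture M m.+2}| <= ell M m.+2.
Proof.
have M_gt0 := card_finMonoid_gt0.
have -> : #|{: juncture M m.+2}| = #|M| * 2 ^ (#|M| ^ m.+1).
  rewrite card_prod; congr (_ * _).
  by rewrite -[LHS]/#|{: {set m.+1.-tuple M}}| -cardsT -powersetT card_powerset cardsT card_tuple.
rewrite /ell /=; set P := 2 ^ (#|M| ^ m); set Q := 2 ^ (#|M| ^ m.+1).
have leP : P <= Q by rewrite leq_exp2l // leq_pexp2l.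
apply: (@leq_trans (9 * m.+1 * #|M| ^ 2 * Q + 9 * (#|M| ^ 2 * Q))).
  by rewrite leq_add ?leq_mul // -{1}(expn1 #|M|) leq_pexp2l.
by rewrite -!mulnA; move: (#|M| ^ 2 * Q) => R; nia.
Qed.

Lemma junctures_rank_anti n k k' : k <= k' ->
  (junctures_rank alpha k' n `<=` junctures_rank alpha k n)%classic.
Proof.
move=> kk' x [xj [w wx xP]]; split=> //; exists w => // t /xP[ws ws_path ws_t].
by exists ws => //; exact: path_lesssim2_mono ws_path.
Qed.

(** Completeness with [k0 = ell M m.+1]. A chain [w :: ws] of that rank is a juncture of length
    [m.+1] with a single tuple; the hypothesis for [m.+1] lifts it to all ranks, which makes it an
    element of [chains]. *)
Lemma junctures_rank_idem_closed m (X : set (juncture M m.+2)) :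
  (junctures_rank alpha (ell M m.+1) m.+1 `<=` junctures alpha m.+1)%classic ->
  idem_closed alpha X -> (diagonal_junctures alpha m.+2 `<=` X)%classic ->
  (X `<=` junctures alpha m.+2)%classic ->
  (junctures_rank alpha (ell M m.+2) m.+2 `<=` X)%classic.
Proof.
move=> IH X_closed X_diagonal X_junctures x /(junctures_rank_anti (ell_step m)).
apply: (junctures_rank_covered alphaP _ X_closed) => //; first exact: ell_gt1.
move=> t [|w ws] /= ws_path ws_t; first by have := size_tuple t; rewrite -ws_t.
have sz_ws : size (map alpha ws) == m by have := size_tuple t; rewrite -ws_t => -[->].
pose t' : m.-tuple M := Tuple sz_ws.
have wJ : junctures alpha m.+1 (alpha w, [set t']%SET).
  (* A singleton is nonempty, as [is_juncture] demands in length 1. *)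
  apply: IH; split; first by move=> _ /setP/(_ t'); rewrite set11 inE.
  by exists w => // s /set1P->; exists ws.
move=> k; have [_ [w' ww' /(_ t' (set11 _))[ws' ws'_path ws'_t]]] := wJ k I.
by exists (w' :: ws') => //; rewrite -ws_t /= ww' ws'_t.
Qed.

Lemma junctures_rank_sub n : 0 < n ->
  (junctures_rank alpha (ell M n) n `<=` junctures alpha n)%classic.
Proof.
case: n => // n _; elim: n => [|m IH].
  move=> x [xj [w wx _]] k _; split=> //; exists w => // t _.
  by exists [::] => //; rewrite (tuple0 t).
apply: junctures_rank_idem_closed => //; first exact: junctures_idem_closed.
exact: diagonal_junctures_sub.
Qed.

Section Saturation.
Variables (n omega : nat).
Hypothesis n_gt1 : 1 < n.
Hypothesis omega_gt0 : 0 < omega.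
Hypothesis omegaP : forall x : juncture M n, (x ^+ omega * x ^+ omega = x ^+ omega)%g.

(** A positive power of a word keeps its alphabet. So the saturation rule at [x] is the idempotent
    rule at [x ^+ omega]. *)
Lemma compatible_chains_power x : junctures alpha n x ->
  compatible_chains alpha n (x ^+ omega)%g.1 = compatible_chains alpha n x.1.
Proof.
move=> xJ; have /junctures_rankE[//|w [wx _]] := xJ 0 I.
apply/setP => t; rewrite !inE fst_expg -wx -morph_power !alph_of_image //.
by rewrite alph_power.
Qed.

Lemma junctures_sat_closed : sat_closed alpha omega n (junctures alpha n).
Proof.
have [J_down J_mul J_idem] := junctures_idem_closed alphaP n_gt1.
split=> // [_ [x xJ [y yJ <-]]|x xJ]; first exact: J_mul.
rewrite -compatible_chains_power //; apply: J_idem => //.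
case: (omega) omega_gt0 => // q _; elim: q => // q IH; rewrite expgS; exact: J_mul.
Qed.

Lemma Sat_smallest (X : set (juncture M n)) : sat_closed alpha omega n X ->
  (diagonal_junctures alpha n `<=` X)%classic ->
  (Sat alpha omega n (diagonal_junctures alpha n) `<=` X)%classic.
Proof.
rewrite /Sat gtn_eqF // => X_closed DX x.
by apply; split.
Qed.

(** An idempotent is its own power of exponent [omega], so the saturation rule specializes to the
    idempotent one. *)
Lemma Sat_idem_closed : idem_closed alpha (Sat alpha omega n (diagonal_junctures alpha n)).
Proof.
rewrite /Sat gtn_eqF //; split.
- move=> x [S xS SP] Y YP; case: (YP) => -[Y_down _ _] _; apply: Y_down; exists S => //.
  exact: xS.
- move=> x y xS yS Y YP; case: (YP) => -[_ Y_mul _] _; apply: Y_mul; exists x; first exact: xS.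
  by exists y => //; exact: yS.
move=> e eS ee Y YP; case: (YP) => -[_ _ Y_pow] _.
by move: (Y_pow _ (eS _ YP)); rewrite (expg_idem omega_gt0 ee).
Qed.

Lemma diagonal_junctures_Sat :
  (diagonal_junctures alpha n `<=` Sat alpha omega n (diagonal_junctures alpha n))%classic.
Proof.
by rewrite /Sat gtn_eqF // => x xD Y [_]; apply.
Qed.
End Saturation.
End Main.

Theorem proposition7p2 (A : finType) (M : finMonoidType)
    (alpha : UMagmaMorphism.type (seq A) M) (n omega : nat)
    (alphaP : alphabet_compatible alpha) (n_ge1 : (1 <= n)%N)
    (omega_ge1 : (1 <= omega)%N)
    (omegaP : forall x : juncture M n,
       (x ^+ omega * x ^+ omega = x ^+ omega)%g) :
  junctures alpha n = junctures_rank alpha (ell M n) n /\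
  junctures_rank alpha (ell M n) n = Sat alpha omega n (diagonal_junctures alpha n).
Proof.
have rank_eq : junctures alpha n = junctures_rank alpha (ell M n) n.
  apply/seteqP; split; last exact: junctures_rank_sub.
  by move=> x; apply.
split=> //; case: n => [//|[|m]] in n_ge1 omegaP rank_eq *.
  (* In length 1 the only tuple is empty and [is_juncture] excludes the empty set, so both sides
     consist of the pairs of [alpha w] with the singleton of the empty tuple. *)
  rewrite /Sat eqxx; apply/seteqP; split=> [[s S] [xj [w ws _]]|_ [w ->]].
    exists w; rewrite ws; congr pair; apply/setP => t.
    have [S0|[t' t'S]] := set_0Vmem S; first by case: (xj erefl).
    by rewrite (tuple0 t) -(tuple0 t') t'S (tuple0 [tuple _ | _ < _]) -(tuple0 t') set11.
  split; first by move=> _ /setP/(_ [tuple alpha w | i < 0]); rewrite set11 inE.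
  by exists w => // t _; exists [::] => //; rewrite (tuple0 t).
have sound := Sat_smallest (isT : 1 < m.+2)
  (junctures_sat_closed alphaP (isT : 1 < m.+2) omega_ge1 omegaP)
  (diagonal_junctures_sub (isT : 1 < m.+2)).
(* One inclusion is completeness for [X] the saturation; the other is [sound], transported along
   [rank_eq]. *)
apply/seteqP; split; last by rewrite -rank_eq.
apply: junctures_rank_idem_closed => //; first exact: junctures_rank_sub.
  exact: Sat_idem_closed.
exact: diagonal_junctures_Sat.
Qed.
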